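(* Let $k$ be a field with $\operatorname{char}(k)\ne2$. Every GDN superalgebra embeds into its universal enveloping associative differential supercommutative algebra. Precisely: let $X=X_0\sqcup X_1$ be a well-ordered set, $S$ a homogeneous subset of $\mathrm{GDN}_s(X)$, and $\varphi:\mathrm{GDN}_s(X)\to(k_s\{X\},\circ)$ the GDN superalgebra homomorphism with $\varphi(a)=a$ ($a\in X$). Then the natural map $\mathrm{GDN}_s(X)/\mathrm{Id}(S)\to k_s\{X\}/\mathrm{Id}_D[\varphi(S)]$ induced by $\varphi$ is an injective homomorphism of GDN superalgebras, where $\mathrm{Id}(S)$ is the GDN superalgebra ideal of $\mathrm{GDN}_s(X)$ generated by $S$, $\mathrm{Id}_D[\varphi(S)]$ is the differential ideal (ideal closed under $D$) of $k_s\{X\}$ generated by $\varphi(S)$, and both quotients carry the product $u\circ v=u\cdot D(v)$ on the target.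
   Context: A superalgebra over $k$ is a vector space $\mathcal A=\mathcal A_0\oplus\mathcal A_1$ with a bilinear product $\circ$ such that $\mathcal A_i\circ\mathcal A_j\subseteq\mathcal A_{i+j}$ (indices mod 2); for nonzero $x\in\mathcal A_i$ write $|x|=i$. A (left) GDN superalgebra is a superalgebra satisfying, for all homogeneous $x,y,z$: $x\circ(y\circ z)-(x\circ y)\circ z=(-1)^{|x||y|}(y\circ(x\circ z)-(y\circ x)\circ z)$ and $(x\circ y)\circ z=(-1)^{|y||z|}(x\circ z)\circ y$. $\mathrm{GDN}_s(X)$ is the free GDN superalgebra on $X=X_0\sqcup X_1$ (elements of $X_i$ of parity $i$). A subset is homogeneous if it is contained in $\mathcal A_0\cup\mathcal A_1$; every GDN superalgebra is of the form $\mathrm{GDN}_s(X)/\mathrm{Id}(S)$ for such $X,S$. An associative differential supercommutative algebra is an associative superalgebra $(\mathcal A,\cdot)$ with $x\cdot y=(-1)^{|x||y|}y\cdot x$ for homogeneous $x,y$, and a parity-preserving linear derivation $D$ ($D(x\cdot y)=Dx\cdot y+x\cdot Dy$). $k_s\{X\}$ is the free such algebra on $X$. For such an algebra, $x\circ y:=x\cdot D(y)$ defines a GDN superalgebra structure. The universal enveloping associative differential supercommutative algebra of a GDN superalgebra $\mathcal A$ is an associative differential supercommutative algebra $\mathcal B$ with a parity-preserving linear map $\psi:\mathcal A\to\mathcal B$ satisfying $\psi(x\circ y)=\psi(x)\cdot D(\psi(y))$, universal among such maps; for $\mathcal A=\mathrm{GDN}_s(X)/\mathrm{Id}(S)$ it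 is $k_s\{X\}/\mathrm{Id}_D[\varphi(S)]$. *)

(* Defs.v *)
From HB Require Import structures.
From mathcomp Require Import all_boot all_algebra.
Set Implicit Arguments. Unset Strict Implicit. Unset Printing Implicit Defensive.
Import GRing.Theory.
Local Open Scope ring_scope.

Definition well_order (X : Type) (R : X -> X -> Prop) : Prop :=
  (forall x, ~ R x x) /\
  (forall x y z, R x y -> R y z -> R x z) /\
  (forall x y, R x y \/ x = y \/ R y x) /\
  well_founded R.

Section Free.
Variables (F : fieldType) (X : Type) (par : X -> bool).

Definition sgn (a b : bool) : F := if a && b then -1 else 1.

(* ---------- Free GDN superalgebra GDN_s(X) as term algebra modulo the
   equational theory of GDN superalgebras over F ---------- *)
Inductive gterm : Type :=
| gvar of X
| gzero
| gadd of gterm & gterm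
| gscale of F & gterm
| gmul of gterm & gterm.

Definition gsub (a b : gterm) := gadd a (gscale (-1) b).

Inductive ghom : gterm -> bool -> Prop :=
| gh_var x : ghom (gvar x) (par x)
| gh_zero b : ghom gzero b
| gh_add a c b : ghom a b -> ghom c b -> ghom (gadd a c) b
| gh_scale k a b : ghom a b -> ghom (gscale k a) b
| gh_mul a c i j : ghom a i -> ghom c j -> ghom (gmul a c) (addb i j).

Inductive gdn_eq : gterm -> gterm -> Prop :=
| ge_refl a : gdn_eq a a
| ge_sym a b : gdn_eq a b -> gdn_eq b a
| ge_trans a b c : gdn_eq a b -> gdn_eq b c -> gdn_eq a c
| ge_add a a' b b' : gdn_eq a a' -> gdn_eq b b' -> gdn_eq (gadd a b) (gadd a' b')
| ge_scale k a a' : gdn_eq a a' -> gdn_eq (gscale k a) (gscale k a')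
| ge_mul a a' b b' : gdn_eq a a' -> gdn_eq b b' -> gdn_eq (gmul a b) (gmul a' b')
| ge_addA a b c : gdn_eq (gadd a (gadd b c)) (gadd (gadd a b) c)
| ge_addC a b : gdn_eq (gadd a b) (gadd b a)
| ge_add0 a : gdn_eq (gadd gzero a) a
| ge_addN a : gdn_eq (gadd a (gscale (-1) a)) gzero
| ge_scale1 a : gdn_eq (gscale 1 a) a
| ge_scaleM k l a : gdn_eq (gscale k (gscale l a)) (gscale (k * l) a)
| ge_scaleDl k l a : gdn_eq (gscale (k + l) a) (gadd (gscale k a) (gscale l a))
| ge_scaleDr k a b : gdn_eq (gscale k (gadd a b)) (gadd (gscale k a) (gscale k b))
| ge_mulDl a b c : gdn_eq (gmul (gadd a b) c) (gadd (gmul a c) (gmul b c))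
| ge_mulDr a b c : gdn_eq (gmul a (gadd b c)) (gadd (gmul a b) (gmul a c))
| ge_mulZl k a b : gdn_eq (gmul (gscale k a) b) (gscale k (gmul a b))
| ge_mulZr k a b : gdn_eq (gmul a (gscale k b)) (gscale k (gmul a b))
| ge_lsym x y z i j l : ghom x i -> ghom y j -> ghom z l ->
    gdn_eq (gsub (gmul x (gmul y z)) (gmul (gmul x y) z))
        (gscale (sgn i j) (gsub (gmul y (gmul x z)) (gmul (gmul y x) z)))
| ge_rcom x y z i j l : ghom x i -> ghom y j -> ghom z l ->
    gdn_eq (gmul (gmul x y) z) (gscale (sgn j l) (gmul (gmul x z) y)).

Inductive gideal (S : gterm -> Prop) : gterm -> Prop :=
| gi_gen s : S s -> gideal S s
| gi_zero : gideal S gzero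
| gi_add a b : gideal S a -> gideal S b -> gideal S (gadd a b)
| gi_scale k a : gideal S a -> gideal S (gscale k a)
| gi_mull a t : gideal S t -> gideal S (gmul a t)
| gi_mulr t a : gideal S t -> gideal S (gmul t a)
| gi_eq t t' : gdn_eq t t' -> gideal S t -> gideal S t'.

Definition gquot (S : gterm -> Prop) (u v : gterm) : Prop := gideal S (gsub u v).

(* ---------- Free associative differential supercommutative algebra
   k_s{X}, as term algebra modulo the corresponding equational theory ---------- *)
Inductive dterm : Type :=
| dvar of X
| dzero
| dadd of dterm & dterm
| dscale of F & dterm
| dmul of dterm & dterm
| dD of dterm.

Definition dsub (a b : dterm) := dadd a (dscale (-1) b).

Inductive dhom : dterm -> bool -> Prop :=
| dh_var x : dhom (dvar x) (par x)
| dh_zero b : dhom dzero b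
| dh_add a c b : dhom a b -> dhom c b -> dhom (dadd a c) b
| dh_scale k a b : dhom a b -> dhom (dscale k a) b
| dh_mul a c i j : dhom a i -> dhom c j -> dhom (dmul a c) (addb i j)
| dh_D a b : dhom a b -> dhom (dD a) b.

Inductive kd_eq : dterm -> dterm -> Prop :=
| de_refl a : kd_eq a a
| de_sym a b : kd_eq a b -> kd_eq b a
| de_trans a b c : kd_eq a b -> kd_eq b c -> kd_eq a c
| de_add a a' b b' : kd_eq a a' -> kd_eq b b' -> kd_eq (dadd a b) (dadd a' b')
| de_scale k a a' : kd_eq a a' -> kd_eq (dscale k a) (dscale k a')
| de_mul a a' b b' : kd_eq a a' -> kd_eq b b' -> kd_eq (dmul a b) (dmul a' b')
| de_D a a' : kd_eq a a' -> kd_eq (dD a) (dD a')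
| de_addA a b c : kd_eq (dadd a (dadd b c)) (dadd (dadd a b) c)
| de_addC a b : kd_eq (dadd a b) (dadd b a)
| de_add0 a : kd_eq (dadd dzero a) a
| de_addN a : kd_eq (dadd a (dscale (-1) a)) dzero
| de_scale1 a : kd_eq (dscale 1 a) a
| de_scaleM k l a : kd_eq (dscale k (dscale l a)) (dscale (k * l) a)
| de_scaleDl k l a : kd_eq (dscale (k + l) a) (dadd (dscale k a) (dscale l a))
| de_scaleDr k a b : kd_eq (dscale k (dadd a b)) (dadd (dscale k a) (dscale k b))
| de_mulDl a b c : kd_eq (dmul (dadd a b) c) (dadd (dmul a c) (dmul b c))
| de_mulDr a b c : kd_eq (dmul a (dadd b c)) (dadd (dmul a b) (dmul a c))
| de_mulZl k a b : kd_eq (dmul (dscale k a) b) (dscale k (dmul a b))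
| de_mulZr k a b : kd_eq (dmul a (dscale k b)) (dscale k (dmul a b))
| de_mulA a b c : kd_eq (dmul a (dmul b c)) (dmul (dmul a b) c)
| de_mulC x y i j : dhom x i -> dhom y j ->
    kd_eq (dmul x y) (dscale (sgn i j) (dmul y x))
| de_DD a b : kd_eq (dD (dadd a b)) (dadd (dD a) (dD b))
| de_DZ k a : kd_eq (dD (dscale k a)) (dscale k (dD a))
| de_DM a b : kd_eq (dD (dmul a b)) (dadd (dmul (dD a) b) (dmul a (dD b))).

Inductive dideal (T : dterm -> Prop) : dterm -> Prop :=
| di_gen s : T s -> dideal T s
| di_zero : dideal T dzero
| di_add a b : dideal T a -> dideal T b -> dideal T (dadd a b)
| di_scale k a : dideal T a -> dideal T (dscale k a)
| di_mull a t : dideal T t -> dideal T (dmul a t)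
| di_mulr t a : dideal T t -> dideal T (dmul t a)
| di_D t : dideal T t -> dideal T (dD t)
| di_eq t t' : kd_eq t t' -> dideal T t -> dideal T t'.

Definition dquot (T : dterm -> Prop) (u v : dterm) : Prop := dideal T (dsub u v).

Definition dcirc (u v : dterm) : dterm := dmul u (dD v).

Fixpoint phi (t : gterm) : dterm :=
  match t with
  | gvar x => dvar x
  | gzero => dzero
  | gadd a b => dadd (phi a) (phi b)
  | gscale k a => dscale k (phi a)
  | gmul a b => dcirc (phi a) (phi b)
  end.

Definition phi_set (S : gterm -> Prop) : dterm -> Prop :=
  fun d => exists s, S s /\ d = phi s.

End Free.

(* Main.v *)
(** Idea.  Let A be the quotient GDN superalgebra.  It suffices to build a
    linear functional on differential polynomials that vanishes on the ideal
    generated by [phi S] and sends [phi t] to the class of [t] in A.  Only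
    monomials of weight -1 matter, i.e. products of m letters [h_i^(n_i)] with
    [m = n_1 + ... + n_m + 1].  If T = t_1 ... t_n, the value of T b^(n) is the
    symmetric brace of the left-symmetric product of A (Oudom and Guin):
    supersymmetry in T uses left symmetry only.  Right commutativity makes all
    operators x |-> x T b^(n) supercommute, since they are generated by right
    multiplications.  Hence an arbitrary monomial of weight -1 can be evaluated
    by contracting its differentiated letters one after the other, n letters
    without derivative being used up by b^(n), and the result depends neither on
    the order nor on the letters chosen.  The evaluation satisfies
    c D(w) = c o w and is compatible with (a o b)^(n) = (a b')^(n). *)

Require Import Defs.
From HB Require Import structures.
From mathcomp Require Import all_boot all_algebra generic_quotient boolp ring zify.
Set Implicit Arguments. Unset Strict Implicit. Unset Printing Implicit Defensive.
Import GRing.Theory.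
Local Open Scope ring_scope.

(** * Koszul signs *)

Section KoszulSign.
Variable F : fieldType.

Lemma sgnC p q : sgn F p q = sgn F q p.
Proof. by rewrite /sgn andbC. Qed.

Lemma sgnK p q : sgn F p q * sgn F p q = 1.
Proof. by case: p; case: q; rewrite /sgn /= ?mulrNN mulr1. Qed.

Variables (A : lmodType F) (L : Type) (pf : L -> bool).

Definition parity (w : seq L) : bool := foldr (fun h p => pf h (+) p) false w.

Lemma par_cat u v : parity (u ++ v) = parity u (+) parity v.
Proof. by elim: u => //= h u ->; rewrite addbA. Qed.

Lemma par_cons h u : parity (h :: u) = pf h (+) parity u.
Proof. by []. Qed.

Definition ssym (G : seq L -> A) := forall U x t V,
  G (U ++ x :: t :: V) = sgn F (pf x) (pf t) *: G (U ++ t :: x :: V).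

End KoszulSign.

Ltac case_atom p :=
  lazymatch p with
  | ?a (+) ?b => first [case_atom a | case_atom b]
  | true => fail
  | false => fail
  | _ => case: (p)
  end.

(** Sign identities are Boolean identities in the parities that occur; splitting on each atomic
    parity leaves products of 1 and -1. *)
Ltac sgn_cases :=
  rewrite ?par_cat ?par_cons /=;
  repeat match goal with
  | |- context [sgn _ ?p ?q] => first [case_atom p | case_atom q]
  | |- context [?p (+) ?q] => first [case_atom p | case_atom q]
  end;
  rewrite /sgn /= ?(mulN1r, mulrN1, mul1r, mulr1, opprK, oppr0).

Section Blocks.
Variables (F : fieldType) (A : lmodType F) (L : Type) (pf : L -> bool).
Local Notation par := (parity pf).
Variable G : seq L -> A.
Hypothesis symG : ssym pf G.

Lemma ssym_letter U x W V :
  G (U ++ x :: W ++ V) = sgn F (pf x) (par W) *: G (U ++ W ++ x :: V).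
Proof.
elim: W U => [|y W IH] U /=; first by rewrite /sgn andbF scale1r.
rewrite symG -cat_rcons IH cat_rcons scalerA; congr (_ *: _).
by sgn_cases.
Qed.

Lemma ssym_letterV U x W V :
  G (U ++ W ++ x :: V) = sgn F (pf x) (par W) *: G (U ++ x :: W ++ V).
Proof. by rewrite ssym_letter scalerA sgnK scale1r. Qed.

Lemma ssym_block U W1 W2 V :
  G (U ++ W1 ++ W2 ++ V) = sgn F (par W1) (par W2) *: G (U ++ W2 ++ W1 ++ V).
Proof.
elim: W1 U => [|y W IH] U /=; first by rewrite scale1r.
rewrite -cat_rcons IH cat_rcons ssym_letter scalerA; congr (_ *: _).
by sgn_cases.
Qed.

End Blocks.

(** In both identities the argument whose parity does not enter the sign ranges over the whole
    space. *)
Record gdnSuper (F : fieldType) := GdnSuper {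
  gcar :> lmodType F;
  gm : gcar -> gcar -> gcar;
  gh : bool -> pred gcar;
  gmDl : forall k x y z, gm (k *: x + y) z = k *: gm x z + gm y z;
  gmDr : forall k x y z, gm z (k *: x + y) = k *: gm z x + gm z y;
  gh0 : forall p, gh p 0;
  ghD : forall p k x y, gh p x -> gh p y -> gh p (k *: x + y);
  ghM : forall p q x y, gh p x -> gh q y -> gh (p (+) q) (gm x y);
  glsym : forall p q x y z, gh p x -> gh q y ->
    gm x (gm y z) - gm (gm x y) z = sgn F p q *: (gm y (gm x z) - gm (gm y x) z);
  grcom : forall p q x y z, gh p y -> gh q z ->
    gm (gm x y) z = sgn F p q *: gm (gm x z) y }.

(** * Symmetric braces *)

Section Brace.
Variables (F : fieldType) (A : gdnSuper F).

(* The parity is a tag, as an element (0 at least) may have both parities. *)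
Record hel := Hel { hv : A; hp : bool; hP : gh hp hv }.
Implicit Types (x t u b : hel) (T U V : seq hel) (G : seq hel -> A).
Local Notation s := (sgn F).
Local Notation par := (parity hp).

Lemma hel_eq x t : hv x = hv t -> hp x = hp t -> x = t.
Proof.
case: x t => [a p Pa] [a' p' Pa'] /= e1 e2; case: _ / e1 e2 Pa' => /= e2 Pa'.
by case: _ / e2 Pa' => Pa'; rewrite (bool_irrelevance Pa Pa').
Qed.

Lemma gm0l (x : A) : gm 0 x = 0.
Proof. by move: (gmDl (-1) 0 0 x); rewrite scaler0 addr0 scaleN1r addNr. Qed.
Lemma gm0r (x : A) : gm x 0 = 0.
Proof. by move: (gmDr (-1) 0 0 x); rewrite scaler0 addr0 scaleN1r addNr. Qed.
Lemma gmZl k (x y : A) : gm (k *: x) y = k *: gm x y.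
Proof. by rewrite -[k *: x]addr0 gmDl gm0l addr0. Qed.
Lemma gmZr k (x y : A) : gm y (k *: x) = k *: gm y x.
Proof. by rewrite -[k *: x]addr0 gmDr gm0r addr0. Qed.
Lemma gmAl (x y z : A) : gm (x + y) z = gm x z + gm y z.
Proof. by rewrite -[x]scale1r gmDl !scale1r. Qed.
Lemma gmAr (x y z : A) : gm z (x + y) = gm z x + gm z y.
Proof. by rewrite -[x]scale1r gmDr !scale1r. Qed.
Lemma gmBr (x y z : A) : gm z (x - y) = gm z x - gm z y.
Proof. by rewrite gmAr -scaleN1r gmZr scaleN1r. Qed.

Lemma ghA p (x y : A) : gh p x -> gh p y -> gh p (x + y).
Proof. by move=> hx hy; rewrite -[x]scale1r ghD. Qed.
Lemma ghZ p k (x : A) : gh p x -> gh p (k *: x).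
Proof. by move=> hx; rewrite -[k *: x]addr0 ghD // gh0. Qed.
Lemma ghB p (x y : A) : gh p x -> gh p y -> gh p (x - y).
Proof. by move=> hx hy; rewrite -scaleN1r ghA // ghZ. Qed.

Definition hmul x t := Hel (ghM (hP x) (hP t)).

(** [hel] carries no vector space structure, so linearity is a condition on three elements with one
    parity tag whose values are linearly related. *)
Definition hlin (K : hel -> A) := forall k h1 h2 h,
  hp h1 = hp h -> hp h2 = hp h -> hv h = k *: hv h1 + hv h2 ->
  K h = k *: K h1 + K h2.

Lemma hlin0 K h : hlin K -> hv h = 0 -> K h = 0.
Proof.
move=> lK h0; have := lK (-1) h h h erefl erefl.
by rewrite h0 scaler0 addr0 scaleN1r addNr => /(_ erefl).
Qed.

Lemma hlinZ K k h h' : hlin K -> hp h' = hp h -> hv h' = k *: hv h ->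
  K h' = k *: K h.
Proof.
move=> lK e1 e2; pose z := Hel (gh0 A (hp h')).
by rewrite (lK k h z h') // ?(hlin0 (h := z) lK) ?addr0.
Qed.

Definition mlin G := forall U V, hlin (fun h => G (U ++ h :: V)).

Lemma mlin_cons G u : mlin G -> mlin (fun U => G (u :: U)).
Proof. by move=> lG U V; apply: (lG (u :: U)). Qed.

(** [G] composed with the superderivation of words that acts on each letter by left multiplication
    by [x]; the signs come from moving [x] to the letter that it hits. *)
Fixpoint dv x G T : A :=
  if T is u :: T' then
    G (hmul x u :: T') + s (hp x) (hp u) *: dv x (fun U => G (u :: U)) T'
  else 0.

Lemma eq_dv x G G' T :
  (forall U, size U = size T -> par U = hp x (+) par T -> G U = G' U) ->
  dv x G T = dv x G' T.
Proof.
elim: T G G' => //= u T IH G G' e; rewrite e ?addbA //.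
by congr (_ + _ *: _); apply: IH => U e1 e2; rewrite e //= ?e1 ?e2 // addbCA.
Qed.

Lemma dv_scale x k G T : dv x (fun U => k *: G U) T = k *: dv x G T.
Proof.
elim: T G => [|u T IH] G /=; first by rewrite scaler0.
by rewrite (IH (fun U => G (u :: U))) scalerDr !scalerA [s _ _ * k]mulrC.
Qed.

Lemma dv_add x G G' T : dv x (fun U => G U + G' U) T = dv x G T + dv x G' T.
Proof.
elim: T G G' => [|u T IH] G G' /=; first by rewrite addr0.
by rewrite (IH (fun U => G (u :: U))) scalerDr addrACA.
Qed.

Lemma dv_sub x G G' T : dv x (fun U => G U - G' U) T = dv x G T - dv x G' T.
Proof.
rewrite dv_add; congr (_ + _); rewrite -scaleN1r -dv_scale.
by apply: eq_dv => U _ _; rewrite scaleN1r.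
Qed.

Lemma dv_gm x (y : A) G T : dv x (fun U => gm y (G U)) T = gm y (dv x G T).
Proof.
elim: T G => [|u T IH] G /=; first by rewrite gm0r.
by rewrite (IH (fun U => G (u :: U))) gmAr gmZr.
Qed.

Lemma mlin_dv x G : mlin G -> mlin (dv x G).
Proof.
move=> lG U V; elim: U G lG => [|u U IH] G lG k h1 h2 h e1 e2 e /=.
  rewrite (lG [::] V k (hmul x h1) (hmul x h2)) /= ?e1 ?e2 ?e ?gmDr //.
  rewrite (eq_dv (G' := fun U => k *: G (h1 :: U) + G (h2 :: U))).
    rewrite (dv_add _ (fun U => k *: G (h1 :: U))) (dv_scale _ _ (fun U => G (h1 :: U))).
    by rewrite !scalerDr !scalerA [_ * k]mulrC addrACA.
  by move=> W _ _; rewrite (lG [::] W k h1 h2).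
rewrite (lG (_ :: U) V k h1 h2) //= (IH _ (mlin_cons u lG) k h1 h2) //.
by rewrite !scalerDr !scalerA [_ * k]mulrC addrACA.
Qed.

Lemma dv_linx G T : mlin G -> hlin (fun x => dv x G T).
Proof.
move=> lG k h1 h2 h e1 e2 e; elim: T G lG => [|u T IH] G lG /=.
  by rewrite scaler0 addr0.
rewrite (lG [::] T k (hmul h1 u) (hmul h2 u)) /= ?e1 ?e2 ?e ?gmDl //.
rewrite (IH _ (mlin_cons u lG)).
by rewrite !scalerDr !scalerA [_ * k]mulrC addrACA.
Qed.

(* The supercommutator of the derivations [dv x] and [dv t] is the derivation
   attached to the supercommutator of [x] and [t]. *)
Lemma dv_comm x t G T : mlin G ->
  dv (hmul x t) G T + s (hp x) (hp t) *: dv x (dv t G) T =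
  s (hp x) (hp t) *: dv (hmul t x) G T + dv t (dv x G) T.
Proof.
elim: T G => [|u T IH] G lG /=; first by rewrite scaler0.
pose Gu U := G (u :: U).
have lGu : mlin Gu by apply: mlin_cons.
rewrite (dv_add x (fun U => G (hmul t u :: U))) (dv_add t (fun U => G (hmul x u :: U))).
rewrite (dv_scale x _ (dv t Gu)) (dv_scale t _ (dv x Gu)).
have := IH _ lGu; rewrite -/Gu.
set a := dv (hmul x t) Gu T; set b := dv x (dv t Gu) T.
set c := dv (hmul t x) Gu T; set d := dv t (dv x Gu) T => E.
set e := dv x _ T; set f := dv t _ T.
(* By linearity both sides equal [G] at the single letter [Hel q5], whose value has two expressions
   by left symmetry. *)
have lsymG : G (hmul (hmul x t) u :: T) + s (hp x) (hp t) *: G (hmul t (hmul x u) :: T) =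
    s (hp x) (hp t) *: G (hmul (hmul t x) u :: T) + G (hmul x (hmul t u) :: T).
  have K := lG [::] T; rewrite /= in K.
  pose q := hp x (+) (hp t (+) hp u).
  have e1 : hp (hmul (hmul x t) u) = q by rewrite /q addbA.
  have e2 : hp (hmul t (hmul x u)) = q by rewrite /q addbCA.
  have e3 : hp (hmul (hmul t x) u) = q by rewrite /q addbCA addbA.
  have e4 : hp (hmul x (hmul t u)) = q by [].
  have q5 : gh q (s (hp x) (hp t) *: hv (hmul t (hmul x u)) + hv (hmul (hmul x t) u)).
    apply: ghD; first by rewrite -e2; apply: (hP (hmul t (hmul x u))).
    by rewrite -e1; apply: (hP (hmul (hmul x t) u)).
  rewrite addrC -(K _ _ _ (Hel q5)) // -(K _ _ _ (Hel q5)) //=.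
  have := glsym (hv u) (hP x) (hP t) => /(canRL (subrK _)) ->.
  by rewrite scalerBr addrA [X in _ = X + _]addrC subrK.
(* Here [v] and [w] are the cross terms, in which one of [x], [t] hits [u] and the other hits [T];
   they occur on both sides. *)
have acH (g1 g2 g3 g4 v a' b' c' d' w : A) : g1 + g2 = g3 + g4 ->
    a' + b' = c' + d' ->
    (g1 + a') + (g2 + v + (w + b')) = (g3 + c') + (g4 + w + (v + d')).
  move=> h1 h2; rewrite [LHS](AC (2*(2*2)) ((1*3)*(2*6)*(5*4))) /= h1 h2.
  by rewrite [LHS](AC (2*2*2) ((1*3)*((2*5)*(6*4)))) /=.
rewrite !scalerDr !scalerA.
have -> : s (hp x) (hp t) * s (hp t) (hp x (+) hp u) = s (hp t) (hp u).
  by sgn_cases.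
have -> : s (hp x) (hp t (+) hp u) = s (hp x) (hp t) * s (hp x) (hp u).
  by sgn_cases.
apply: acH => //.
pose k := s (hp x) (hp u) * s (hp t) (hp u).
have -> : s (hp x (+) hp t) (hp u) = k by rewrite /k; sgn_cases.
have -> : s (hp t (+) hp x) (hp u) = k by rewrite /k; sgn_cases.
rewrite -[_ * _ * s (hp t) (hp u)]mulrA -/k [s (hp t) (hp u) * _]mulrC -/k.
rewrite ![s (hp x) (hp t) * k]mulrC -!scalerA -!scalerDr.
by rewrite -[in LHS]/(Gu) E.
Qed.

Lemma gh_dv p x G T :
  (forall U, size U = size T -> par U = hp x (+) par T -> gh p (G U)) ->
  gh p (dv x G T).
Proof.
elim: T G => [|u T IH] G hG /=; first exact: gh0.
apply: ghA; first by apply: hG; rewrite //= addbA.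
by apply: ghZ; apply: IH => U e1 e2; apply: hG; rewrite /= ?e1 // e2 addbCA.
Qed.

(* Stands for the word T b^(n) with n = size T; the recursion is Leibniz' rule
   x (T b^(n))' = x T b^(n+1) + x T' b^(n), with fuel because [dv] changes the
   entries of the list. *)
Fixpoint brn n T b : A :=
  match n, T with
  | n'.+1, x :: T' => gm (hv x) (brn n' T' b) - dv x (fun U => brn n' U b) T'
  | _, _ => hv b
  end.
Definition br b T : A := brn (size T) T b.
Arguments br : simpl never.

(** The recursion freed of its fuel: [dv] evaluates its function only on words as long as [T]. *)
Lemma br_cons b x T : br b (x :: T) = gm (hv x) (br b T) - dv x (br b) T.
Proof.
by rewrite /br /=; congr (_ - _); apply: eq_dv => U -> _.
Qed.

Lemma size_ind (P : seq hel -> Prop) :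
  (forall T, (forall U, size U < size T -> P U)%N -> P T) -> forall T, P T.
Proof.
move=> IH T; have [n] := ubnP (size T); elim: n T => // n IHn T leT.
by apply: IH => U ltU; apply: IHn; apply: leq_trans ltU _.
Qed.

Lemma gh_br b T : gh (par T (+) hp b) (br b T).
Proof.
elim/size_ind: T => -[|x T] IH; first exact: hP.
rewrite br_cons; apply: ghB.
  by rewrite par_cons -addbA; apply: ghM (hP x) (IH _ _) => /=.
apply: gh_dv => U sU /esym pU; rewrite par_cons -/par pU.
by apply: IH; rewrite sU /=.
Qed.

Definition bh b T : hel := Hel (gh_br b T).

Lemma hlin_br T : hlin (br^~ T).
Proof.
elim/size_ind: T => -[|x T] IH k h1 h2 h e1 e2 e //.
rewrite !br_cons (IH T _ k h1 h2) //= gmDr.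
rewrite (eq_dv (G' := fun U => k *: br h1 U + br h2 U)).
  rewrite (dv_add _ (fun U => k *: br h1 U)) (dv_scale _ _ (br h1)).
  by rewrite scalerBr opprD addrACA.
by move=> U sU _; apply: IH; rewrite ?sU //=.
Qed.

Lemma mlin_br b : mlin (br b).
Proof.
move=> U V; have [n] := ubnP (size U + size V)%N.
elim: n U V => // n IHn U V ltn.
(* truncation makes the induction hypothesis an instance of [mlin] *)
pose G T := if (size T <= n)%N then br b T else 0.
have lG : mlin G.
  move=> W1 W2 k h1 h2 h e1 e2 e; rewrite /G !size_cat /= !addnS.
  case: ltnP => le; last by rewrite scaler0 addr0.
  exact: (IHn W1 W2).
have GE x T : (size T <= n)%N -> dv x (br b) T = dv x G T.
  by move=> leT; apply: eq_dv => W sW _; rewrite /G sW leT.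
case: U ltn => [|u U] /=; rewrite ?add0n ?addSn ltnS => len k h1 h2 h e1 e2 e.
  rewrite /= !br_cons e gmDl !GE // (dv_linx V lG e1 e2 e) //.
  by rewrite scalerBr opprD addrACA.
rewrite !br_cons !GE ?size_cat /= ?addnS //.
rewrite (mlin_dv u lG U V e1 e2 e) //.
rewrite (IHn U V _ k h1 h2) //.
by rewrite gmDr scalerBr opprD addrACA.
Qed.

Definition ssymat k G := forall U x t V, size U = k ->
  G (U ++ x :: t :: V) = s (hp x) (hp t) *: G (U ++ t :: x :: V).

(** At position 0 the transposition exchanges the two terms in which [y] hits [x] or [t]; the
    symmetry of [G] handles those in which [y] hits a later letter. Other positions follow by
    induction. *)
Lemma ssymat_dv k y G : ssymat k G -> ssymat k (dv y G).
Proof.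
elim: k G => [|k IH] G symG U x t V.
  move/size0nil => -> /=.
  have E := symG [::]; rewrite /= in E.
  rewrite (E (hmul y x)) // (E x (hmul y t)) //=.
  rewrite (eq_dv (G' := fun U => s (hp x) (hp t) *: G (t :: x :: U))); last first.
    by move=> W _ _; rewrite (E x t).
  rewrite (dv_scale _ _ (fun U => G (t :: x :: U))).
  rewrite !scalerDr !scalerA addrCA.
  congr (_ *: _ + (_ *: _ + _ *: _)); sgn_cases => //.
case: U => //= u U [sU]; have sGu : ssymat k (fun U => G (u :: U)).
  by move=> W x' t' V' sW; apply: (symG (u :: W)); rewrite /= sW.
rewrite (symG (_ :: U)) /= ?sU // (IH _ sGu) // scalerDr !scalerA.
by rewrite [s (hp y) _ * _]mulrC.
Qed.

(** For the first two letters, unfolding the recursion twice gives an associator, a pair of cross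
    terms and a second-order term. They are supersymmetric by left symmetry, by inspection and by
    [dv_comm]. Later positions are inherited through [ssymat_dv]. *)
Lemma ssym_br b : ssym hp (br b).
Proof.
suff H k : ssymat k (br b) by move=> U x t V; apply: (H (size U)).
elim: k => [|k IH] U x t V.
  move/size0nil => -> /=.
  have E x' t' : br b (x' :: t' :: V) =
    (gm (hv x') (gm (hv t') (br b V)) - gm (gm (hv x') (hv t')) (br b V))
    - (gm (hv x') (dv t' (br b) V) + s (hp x') (hp t') *: gm (hv t') (dv x' (br b) V))
    + (dv (hmul x' t') (br b) V + s (hp x') (hp t') *: dv x' (dv t' (br b)) V).
    rewrite !br_cons /= br_cons gmBr.
    rewrite (eq_dv (G := fun U => br b (t' :: U))
      (G' := fun U => gm (hv t') (br b U) - dv t' (br b) U)); last first.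
      by move=> W _ _; exact: br_cons.
    rewrite (dv_sub _ (fun U => gm (hv t') (br b U))) dv_gm scalerBr.
    rewrite !opprD !opprK.
    by rewrite [LHS](AC (2*(2*2)) ((1*3)*(2*5)*(4*6))) /=.
  rewrite !E (glsym _ (hP x) (hP t)) (dv_comm _ _ _ (mlin_br b)).
  rewrite [RHS]scalerDr [X in _ = X + _]scalerBr [X in _ = _ - X + _]scalerDr.
  rewrite [X in _ = _ - (_ + X) + _]scalerA [s (hp t) (hp x)]sgnC sgnK scale1r.
  congr (_ - _ + _); first by rewrite addrC.
  by rewrite scalerDr scalerA sgnK scale1r.
case: U => //= u U [sU]; rewrite !br_cons (IH U) // gmZr (ssymat_dv u IH) //.
by rewrite scalerBr.
Qed.

(** Lets a linear function of letters pass through the sum [dv x G T]: [gH] packs the values of [G]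
    as letters, and since all words in the sum have one parity, the partial sums are letters too. *)
Lemma dv_pack K x G (gH : seq hel -> hel) p T h : hlin K ->
  (forall U, hv (gH U) = G U) -> (forall U, hp (gH U) = par U (+) p) ->
  hv h = dv x G T -> hp h = hp x (+) par T (+) p ->
  K h = dv x (fun U => K (gH U)) T.
Proof.
move=> lK; elim: T G gH p h => [|u T IH] G gH p h gHv gHp /= eh ep.
  exact: hlin0 lK eh.
have dP : gh (hp h) (dv x (fun U => G (u :: U)) T).
  apply: gh_dv => U _ pU; rewrite -gHv; have := hP (gH (u :: U)).
  by rewrite gHp par_cons pU ep addbCA addbA.
rewrite (lK (s (hp x) (hp u)) (Hel dP) (gH (hmul x u :: T)) h) //=.
- rewrite addrC; congr (_ + _ *: _).
  apply: (IH (fun U => G (u :: U)) (fun U => gH (u :: U)) (hp u (+) p)) => //=.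
    by move=> U; rewrite gHp par_cons -addbA addbCA.
  by rewrite ep /=; sgn_cases.
- by rewrite gHp ep /= addbA.
- by rewrite eh gHv addrC.
Qed.

(* The operator acts from the right: it is moved past the letters that follow
   its argument. *)
Record sop := Sop {
  ov : hel -> A;
  opar : bool;
  ov_lin : hlin ov;
  ov_hom : forall x, gh (hp x (+) opar) (ov x);
  ov_comm : forall x c, ov (hmul x c) = s opar (hp c) *: gm (ov x) (hv c) }.

Definition app P x : hel := Hel (ov_hom P x).

(** The hypothesis lets the operator enter at any letter. In each term of [dv] it is put on the
    letter [hmul x u] that was hit, from which [ov_comm] passes it to [x]. *)
Lemma sop_dv P x r G1 G2 T : mlin G2 ->
  (forall U y V, size (U ++ y :: V) = size T ->
    G1 (U ++ y :: V) = s (opar P) (par V (+) r) *: G2 (U ++ app P y :: V)) ->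
  dv x G1 T = s (opar P) (par T (+) r) *: dv (app P x) G2 T.
Proof.
elim: T G1 G2 => [|u T IH] G1 G2 lG E /=; first by rewrite scaler0.
have lG' := lG [::] T; rewrite /= in lG'.
rewrite (E [::]) // (hlinZ (k := s (opar P) (hp u)) lG' (h := hmul (app P x) u)
    (h' := app P (hmul x u))) /=.
- rewrite (IH _ (fun U => G2 (u :: U))) //.
    rewrite scalerDr !scalerA; congr (_ *: _ + _ *: _);
      by sgn_cases.
  + exact: mlin_cons.
  + by move=> U y V sz; rewrite (E (u :: U)) //= sz.
- by rewrite addbAC.
- exact: ov_comm.
Qed.

(** An operator that supercommutes with right multiplications moves into the first letter of a
    brace. In the recursion for the brace, [ov_comm] treats the product and [sop_dv] the derivation
    term, whose braces are shorter. *)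
Lemma sop_br P b x T :
  ov P (bh b (x :: T)) = s (opar P) (par T (+) hp b) *: br b (app P x :: T).
Proof.
elim/size_ind: T x => T IH x.
have dP : gh (hp x (+) (par T (+) hp b)) (dv x (br b) T).
  by apply: gh_dv => U _ pU; have := hP (bh b U); rewrite /= pU addbA.
rewrite (ov_lin P (k := -1) (h1 := Hel dP) (h2 := hmul x (bh b T))) /=.
- rewrite ov_comm br_cons /= scalerBr scaleN1r addrC; congr (_ - _).
  rewrite (dv_pack (G := br b) (gH := bh b) (p := hp b) (T := T) (x := x) (ov_lin P)) //=.
    apply: sop_dv; first exact: mlin_br.
    move=> U y V sz.
    have sUV : (size (U ++ V) < size T)%N by rewrite -sz !size_cat /= addnS.
    (* The letter [y] may stand anywhere in the word; supersymmetry brings it to the front, where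
       the induction hypothesis applies. *)
    have symK (Q : hel -> A) : hlin Q ->
        Q (bh b (U ++ y :: V)) = s (hp y) (par U) *: Q (bh b (y :: U ++ V)).
      move=> lQ; apply: (hlinZ lQ) => /=; first by rewrite !par_cat /= addbCA.
      have := ssym_letter (@ssym_br b) [::] y U V; rewrite /= => ->.
      by rewrite scalerA sgnK scale1r.
    rewrite (symK _ (ov_lin P)) IH //.
    have /= -> := ssym_letter (@ssym_br b) [::] (app P y) U V.
    rewrite !scalerA; congr (_ *: _); rewrite par_cat.
    by sgn_cases.
  by rewrite addbA.
- by rewrite addbA.
- by rewrite addbA.
- by rewrite br_cons scaleN1r addrC.
Qed.

Lemma rsop_comm (x c d : hel) : gm (gm (hv x) (hv d)) (hv c) =
  s (hp c) (hp d) *: gm (gm (hv x) (hv c)) (hv d).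
Proof. by rewrite (grcom _ (hP d) (hP c)) sgnC. Qed.

Definition rsop c : sop := Sop (ov := fun x => gm (hv x) (hv c))
  (fun k h1 h2 h _ _ e => etrans (congr1 (fun a => gm a (hv c)) e) (gmDl _ _ _ _))
  (fun x => ghM (hP x) (hP c)) (fun x d => rsop_comm x c d).

(** Right multiplications are themselves such operators, by right commutativity, so [sop_br] applies
    to them. The result makes the brace, as a function of its first letter, an operator of the same
    kind. *)
Lemma bsop_comm b T x c : br b (hmul x c :: T) =
  s (par T (+) hp b) (hp c) *: gm (br b (x :: T)) (hv c).
Proof.
have := sop_br (rsop c) b x T; rewrite /= => ->.
rewrite scalerA [s _ (hp c)]sgnC sgnK scale1r.
by congr (br b (_ :: T)); apply: hel_eq.
Qed.

Lemma bsop_hom b T x : gh (hp x (+) (par T (+) hp b)) (br b (x :: T)).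
Proof. by have := gh_br b (x :: T); rewrite par_cons addbA. Qed.

Definition bsop b T : sop := Sop (ov := fun x => br b (x :: T))
  (@mlin_br b [::] T) (bsop_hom b T) (bsop_comm b T).

End Brace.

Arguments br : simpl never.

Definition letter (F : fieldType) (A : gdnSuper F) := (hel A * nat)%type.
Definition lp (F : fieldType) (A : gdnSuper F) (l : letter A) : bool := hp l.1.

Ltac sgn_w := rewrite /= ?par_cat ?par_cons /lp /=; sgn_cases.

(** * Contraction of letters *)

Section Words.
Variables (F : fieldType) (A : gdnSuper F).
Local Notation hel := (hel A).
Local Notation letter := (letter A).
Local Notation lp := (@lp F A).
Local Notation s := (sgn F).
Local Notation par := (parity (@hp F A)).
Local Notation wpar := (parity lp).
Implicit Types (x t u b : hel) (T U V : seq hel) (G : seq hel -> A).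
Implicit Types (P Q : seq letter) (w v : seq letter).

(* Evaluates Z ++ P, where the zeros Z carry no derivative and (b, n) in P
   stands for b^(n+1): the first n+1 zeros and b are contracted to one zero. *)
Fixpoint blk Z P : A :=
  match P with
  | [::] => if Z is [:: x] then hv x else 0
  | (b, n) :: P' =>
    if (n < size Z)%N then
      s (hp b) (par (drop n.+1 Z)) *:
        blk (bh b (take n.+1 Z) :: drop n.+1 Z) P'
    else 0
  end.

Lemma blk_cat Z1 Z2 b n P : size Z1 = n.+1 ->
  blk (Z1 ++ Z2) ((b, n) :: P) = s (hp b) (par Z2) *: blk (bh b Z1 :: Z2) P.
Proof.
by move=> sz /=; rewrite size_cat sz addSn ltnS leq_addr -sz take_size_cat // drop_size_cat.
Qed.

Lemma blk_small Z b n P : (size Z <= n)%N -> blk Z ((b, n) :: P) = 0.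
Proof. by move=> le /=; rewrite ltnNge le. Qed.

Arguments blk : simpl never.

Lemma split_size (T : Type) (Z : seq T) n : (n <= size Z)%N ->
  exists Z1 Z2, Z = Z1 ++ Z2 /\ size Z1 = n.
Proof.
by move=> le; exists (take n Z), (drop n Z); rewrite cat_take_drop size_takel.
Qed.

Lemma gh_blk Z P : gh (par Z (+) wpar P) (blk Z P).
Proof.
elim: P Z => [|[b n] P IH] Z.
  case: Z => [|x [|y Z]]; rewrite /blk /= ?addbF; [exact: gh0|exact: hP|exact: gh0].
case: (leqP (size Z) n) => [le|]; first by rewrite blk_small // gh0.
case/split_size => Z1 [Z2 [-> sZ]]; rewrite blk_cat //; apply: ghZ.
have := IH (bh b Z1 :: Z2); rewrite !par_cons par_cat /= /lp /=.
by rewrite -!addbA [hp b (+) (par Z2 (+) _)]addbCA.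
Qed.

Definition blkh Z P : hel := Hel (gh_blk Z P).

Lemma mlin_blk P : mlin (blk^~ P).
Proof.
elim: P => [|[b n] P IH] U V k h1 h2 h e1 e2 e; cbv beta.
  by case: U V => [|x [|y U]] [|z V]; rewrite /blk /= ?scaler0 ?addr0.
case: (leqP (size (U ++ h :: V)) n) => [le|].
  have le' x : (size (U ++ x :: V) <= n)%N by move: le; rewrite !size_cat.
  by rewrite !blk_small // scaler0 addr0.
case: (ltnP n (size U)) => [/split_size [U1 [U2 [-> sU]]] _|leU].
  rewrite -!catA !blk_cat // (IH (_ :: U2) V k h1 h2) //=.
  by rewrite scalerDr !scalerA [_ * k]mulrC !par_cat !par_cons e1 e2.
rewrite size_cat /= addnS ltnS -leq_subLR => /split_size [V1 [V2 [-> sV]]].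
have sz x : size (U ++ x :: V1) = n.+1 by rewrite size_cat /= sV addnS subnKC.
have E x : U ++ x :: V1 ++ V2 = (U ++ x :: V1) ++ V2 by rewrite -catA.
rewrite !E !blk_cat // (IH [::] V2 k (bh b (U ++ h1 :: V1)) (bh b (U ++ h2 :: V1))).
- by rewrite scalerDr !scalerA [_ * k]mulrC.
- by rewrite /= !par_cat !par_cons e1.
- by rewrite /= !par_cat !par_cons e2.
- exact: (@mlin_br _ _ b U V1).
Qed.

(** The first zero takes part in every contraction, so [sop_br] carries the operator inwards one
    contraction at a time. *)
Lemma sop_blk Phi x Z P : ov Phi (blkh (x :: Z) P) =
  s (opar Phi) (par Z (+) wpar P) *: blk (app Phi x :: Z) P.
Proof.
elim: P x Z => [|[b n] P IH] x Z.
  case: Z => [|y Z]; last by rewrite /blk /= scaler0; apply: (hlin0 (ov_lin Phi)).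
  rewrite /blk /= /sgn andbF scale1r; congr (ov _ _); apply: hel_eq => //=.
  by rewrite !addbF.
case: (ltnP (size Z) n) => [lt|/split_size [T [Z2 [-> sT]]]].
  rewrite blk_small // scaler0; apply: (hlin0 (ov_lin Phi)).
  by rewrite /= blk_small.
have blkE y : blk (y :: T ++ Z2) ((b, n) :: P) =
    s (hp b) (par Z2) *: blk (bh b (y :: T) :: Z2) P.
  by rewrite -cat_cons blk_cat //= sT.
rewrite (hlinZ (k := s (hp b) (par Z2)) (h := blkh (bh b (x :: T) :: Z2) P) (ov_lin Phi)).
- rewrite IH blkE.
  rewrite (hlinZ (k := s (opar Phi) (par T (+) hp b)) (h := bh b (app Phi x :: T))
    (h' := app Phi (bh b (x :: T))) (@mlin_blk P [::] Z2)) /=.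
  + by rewrite !scalerA; congr (_ *: _); sgn_w.
  + by sgn_w.
  + exact: sop_br.
- by sgn_w.
- by rewrite /= blkE.
Qed.

Lemma blk_ssym P : ssym (@hp F A) (blk^~ P).
Proof.
elim: P => [|[b n] P IH] U c d V; cbv beta.
  by case: U => [|x [|y U]]; rewrite /blk /= scaler0.
have sz x y : size (U ++ x :: y :: V) = (size U + size V).+2.
  by rewrite size_cat /= !addnS.
case: (leqP (size U + size V).+2 n) => [le|lt].
  by rewrite !blk_small ?sz // scaler0.
case: (ltngtP (size U) n) => [ltU|/split_size [U1 [U2 [-> sU]]]|sU].
- have : (n.+1 - (size U).+2 <= size V)%N by rewrite leq_subLR !addSn.
  case/split_size => V1 [V2 [-> sV]].
  have E x y : blk (U ++ x :: y :: V1 ++ V2) ((b, n) :: P) =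
      s (hp b) (par V2) *: blk (bh b (U ++ x :: y :: V1) :: V2) P.
    have -> : U ++ x :: y :: V1 ++ V2 = (U ++ x :: y :: V1) ++ V2 by rewrite -catA.
    by apply: blk_cat; rewrite size_cat /= sV !addnS -!addSn subnKC.
  rewrite !E (hlinZ (k := s (hp c) (hp d)) (h := bh b (U ++ d :: c :: V1))
    (h' := bh b (U ++ c :: d :: V1)) (@mlin_blk P [::] V2)) /=.
  + by rewrite !scalerA mulrC.
  + by sgn_w.
  + exact: ssym_br.
- rewrite -!catA !blk_cat // (IH (_ :: U2)) !scalerA mulrC; congr (_ * _ *: _).
  by sgn_w.
(* The pair straddles the end of the first contracted block. Its contraction is [bsop b U] applied
   to [x]; with this operator extracted, both letters are zeros for [P] and the induction hypothesis
   exchanges them. *)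
- have E x y : blk (U ++ x :: y :: V) ((b, n) :: P) =
      (s (hp b) (par (y :: V)) * s (hp x) (par U)
        * s (par U (+) hp b) (par (y :: V) (+) wpar P)) *:
      ov (bsop b U) (blkh (x :: y :: V) P).
    rewrite -cat_rcons blk_cat ?size_rcons ?sU //.
    rewrite (hlinZ (k := s (hp x) (par U)) (h := app (bsop b U) x)
      (h' := bh b (rcons U x))
      (@mlin_blk P [::] (y :: V))).
    + by rewrite sop_blk !scalerA; congr (_ *: _); sgn_w.
    + by rewrite -cats1; sgn_w.
    + have := ssym_letter (@ssym_br _ _ b) [::] x U [::].
      by rewrite /= cats0 cats1 => ->; rewrite scalerA sgnK scale1r.
  rewrite !E (hlinZ (k := s (hp c) (hp d)) (h := blkh (d :: c :: V) P)
    (h' := blkh (c :: d :: V) P) (ov_lin _)).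
  + by rewrite !scalerA; congr (_ *: _); sgn_w.
  + by sgn_w.
  + exact: (IH [::]).
Qed.

Lemma mlin_blkP Z P n Q :
  hlin (fun b => blk Z (P ++ (b, n) :: Q)).
Proof.
elim: P Z => [|[b m] P IH] Z k h1 h2 h e1 e2 e /=.
  case: (leqP (size Z) n) => [le|/split_size [Z1 [Z2 [-> sZ]]]].
    by rewrite !blk_small // scaler0 addr0.
  rewrite !blk_cat // (@mlin_blk Q [::] Z2 k (bh h1 Z1) (bh h2 Z1)) /= ?e1 ?e2 //.
    by rewrite scalerDr !scalerA [_ * k]mulrC.
  exact: hlin_br.
case: (leqP (size Z) m) => [le|/split_size [Z1 [Z2 [-> sZ]]]].
  by rewrite !blk_small // scaler0 addr0.
by rewrite !blk_cat // (IH _ k h1 h2) // scalerDr !scalerA [_ * k]mulrC.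
Qed.

(** Two successive contractions apply two brace operators to the first zero, and these supercommute
    by [sop_br] for [bsop]. *)
Lemma blk_ssymP Z : ssym lp (blk Z).
Proof.
move=> U; elim: U Z => [|[b m] U IH] Z [c i] [d j] Q /=; last first.
  case: (leqP (size Z) m) => [le|/split_size [Z1 [Z2 [-> sZ]]]].
    by rewrite !blk_small // scaler0.
  by rewrite !blk_cat // IH !scalerA mulrC.
have small e1 n1 e2 n2 : (size Z <= n1 + n2)%N ->
    blk Z ((e1, n1) :: (e2, n2) :: Q) = 0.
  move=> le; case: (leqP (size Z) n1) => [le1|]; first by rewrite blk_small.
  case/split_size=> Z1 [Z2 [eZ sZ]]; rewrite eZ blk_cat // blk_small ?scaler0 //=.
  by move: le; rewrite eZ size_cat sZ addSn -addnS leq_add2l.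
(* The two contractions need i + j + 1 zeros: the second one also uses the zero produced by the
   first. *)
case: (leqP (size Z) (i + j)) => [le|]; first by rewrite !small // 1?addnC // scaler0.
case: Z {small} => // x Z; rewrite ltnS => /split_size [T [Z3 [-> sT]]].
have /split_size [Z1 [Z2 [eT s1]]] : (i <= size T)%N by rewrite sT leq_addr.
have s2 : size Z2 = j by apply/eqP; rewrite -(eqn_add2l i) -sT eT size_cat s1.
have E b1 n1 b2 n2 T1 T2 : size T1 = n1 -> size T2 = n2 ->
    blk (x :: (T1 ++ T2) ++ Z3) ((b1, n1) :: (b2, n2) :: Q) =
    (s (hp b1) (par (T2 ++ Z3)) * s (hp b2) (par Z3)) *:
      blk (bh b2 (bh b1 (x :: T1) :: T2) :: Z3) Q.
  move=> <- <-; rewrite -catA -cat_cons blk_cat // -cat_cons blk_cat //.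
  by rewrite scalerA.
(* The zeros are reordered so that [c] consumes [Z1] and [d] consumes [Z2] in either order of
   contraction. *)
have swap : blk (x :: (Z1 ++ Z2) ++ Z3) ((d, j) :: (c, i) :: Q) =
    s (par Z1) (par Z2) *: blk (x :: (Z2 ++ Z1) ++ Z3) ((d, j) :: (c, i) :: Q).
  by have := ssym_block (@blk_ssym ((d, j) :: (c, i) :: Q)) [:: x] Z1 Z2 Z3; rewrite /= !catA.
rewrite eT swap !E //.
rewrite (hlinZ (k := s (par Z2 (+) hp d) (par Z1 (+) hp c))
  (h := bh c (bh d (x :: Z2) :: Z1)) (h' := bh d (bh c (x :: Z1) :: Z2))
  (@mlin_blk Q [::] Z3)) /=.
- by rewrite !scalerA; congr (_ *: _); sgn_w.
- by sgn_w.
- have := sop_br (bsop d Z2) c x Z1; rewrite /= => ->; congr (_ *: br _ (_ :: _)).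
  by apply: hel_eq => //=; rewrite addbA.
Qed.

End Words.

Arguments blk : simpl never.

(** * Words and their values *)

Section Value.
Variables (F : fieldType) (A : gdnSuper F).
Local Notation hel := (hel A).
Local Notation letter := (letter A).
Local Notation lp := (@lp F A).
Local Notation s := (sgn F).
Local Notation par := (parity (@hp F A)).
Local Notation wpar := (parity lp).
Implicit Types (x t b : hel) (P Q U V u w v : seq letter) (G : seq letter -> A).

Fixpoint zeros w : seq hel :=
  match w with
  | [::] => [::]
  | (h, 0%N) :: w' => h :: zeros w'
  | _ :: w' => zeros w'
  end.

(** Exponents are stored lowered by one, the convention of [blk]. *)
Fixpoint posit w : seq letter :=
  match w with
  | [::] => [::]
  | (h, n.+1) :: w' => (h, n) :: posit w'
  | _ :: w' => posit w'
  end.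

(** The Koszul sign of moving all differentiated letters behind the letters without derivative. *)
Fixpoint sortsgn w : F :=
  match w with
  | [::] => 1
  | (h, n.+1) :: w' => s (hp h) (par (zeros w')) * sortsgn w'
  | _ :: w' => sortsgn w'
  end.

Lemma zeros_cat w v : zeros (w ++ v) = zeros w ++ zeros v.
Proof. by elim: w => [|[h [|n]] w IH] //=; rewrite IH. Qed.

Lemma posit_cat w v : posit (w ++ v) = posit w ++ posit v.
Proof. by elim: w => [|[h [|n]] w IH] //=; rewrite IH. Qed.

Lemma sortsgn_cat w v : sortsgn (w ++ v) =
  sortsgn w * sortsgn v * s (wpar (posit w)) (par (zeros v)).
Proof.
elim: w => [|[h [|n]] w IH] /=; first by rewrite mul1r mulr1.
  by rewrite IH.
by rewrite IH zeros_cat; sgn_w; ring.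
Qed.

(* The word (h_1, n_1) ... (h_m, n_m) stands for h_1^(n_1) ... h_m^(n_m); its
   value is zero unless m = n_1 + ... + n_m + 1. *)
Definition wev w : A := sortsgn w *: blk (zeros w) (posit w).

(** Two zeros are exchanged by [blk_ssym], two differentiated letters by [blk_ssymP]; for a mixed
    pair only the sorting sign changes. *)
Lemma wev_ssym : ssym lp wev.
Proof.
move=> U [c i] [d j] V; rewrite /wev !zeros_cat !posit_cat !sortsgn_cat.
case: i j => [|i] [|j] /=.
- by rewrite blk_ssym !scalerA; congr (_ *: _); sgn_w; ring.
- by rewrite !scalerA; congr (_ *: _); sgn_w; ring.
- by rewrite !scalerA; congr (_ *: _); sgn_w; ring.
- by rewrite blk_ssymP !scalerA; congr (_ *: _); sgn_w; ring.
Qed.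

Definition wmlin G := forall U V n, hlin (fun h => G (U ++ (h, n) :: V)).

Lemma wev_mlin : wmlin wev.
Proof.
move=> U V n k h1 h2 h e1 e2 e; rewrite /wev !zeros_cat !posit_cat !sortsgn_cat.
case: n => [|n] /=.
  rewrite (@mlin_blk _ _ _ (zeros U) (zeros V) k h1 h2) // e1 e2.
  by rewrite scalerDr !scalerA [_ * k]mulrC.
rewrite (@mlin_blkP _ _ _ (posit U) n (posit V) k h1 h2) // e1 e2.
by rewrite scalerDr !scalerA [_ * k]mulrC.
Qed.

Definition zw (Z : seq hel) : seq letter := [seq (h, 0%N) | h <- Z].

Lemma zeros_zw Z : zeros (zw Z) = Z.
Proof. by elim: Z => //= h Z ->. Qed.
Lemma posit_zw Z : posit (zw Z) = [::].
Proof. by elim: Z. Qed.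
Lemma sortsgn_zw Z : sortsgn (zw Z) = 1.
Proof. by elim: Z. Qed.
Lemma wpar_zw Z : wpar (zw Z) = par Z.
Proof. by elim: Z => //= h Z ->. Qed.

Lemma wev_contract0 Z b n V : size Z = n.+1 ->
  wev (zw Z ++ (b, n.+1) :: V) = wev ((bh b Z, 0%N) :: V).
Proof.
move=> sZ; rewrite /wev !zeros_cat !posit_cat !sortsgn_cat /=.
rewrite zeros_zw posit_zw sortsgn_zw /= blk_cat // !scalerA; congr (_ *: _).
by sgn_w; ring.
Qed.

(** Supersymmetry brings the block to the front, where the evaluation contracts it first. Hence the
    choice of contraction is free. *)
Lemma wev_contract U Z b n V : size Z = n.+1 ->
  wev (U ++ zw Z ++ (b, n.+1) :: V) = wev (U ++ (bh b Z, 0%N) :: V).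
Proof.
move=> sZ; have := ssym_block wev_ssym [::] U (zw Z ++ [:: (b, n.+1)]) V.
rewrite -catA /= => ->; rewrite -catA /= wev_contract0 //.
have := ssym_letter wev_ssym [::] (bh b Z, 0%N) U V; rewrite /= => ->.
by rewrite scalerA -[RHS]scale1r; congr (_ *: _); rewrite !par_cat wpar_zw; sgn_w.
Qed.

Lemma wev_mul U x t V :
  wev (U ++ (hmul x t, 0%N) :: V) = wev (U ++ (x, 0%N) :: (t, 1%N) :: V).
Proof.
rewrite (@wev_contract U [:: x] t 0 V) //; congr (wev (U ++ (_, _) :: V)).
by apply: hel_eq; rewrite /= ?addbF // br_cons /= subr0.
Qed.

(** * Weight and derivation of words *)

Definition worder w : nat := sumn (map snd w).

Lemma size_zeros_posit w : size w = (size (zeros w) + size (posit w))%N.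
Proof. by elim: w => [|[h [|n]] w /= ->] //; rewrite addnS. Qed.

Lemma worder_posit w : worder w = (worder (posit w) + size (posit w))%N.
Proof.
rewrite /worder; elim: w => [|[h [|n]] w /= ->] //.
by rewrite addnS addSn addnA.
Qed.

(** A contraction with exponent n + 1 lowers both the length and the total order by n + 1, and the
    process must end at a single zero. *)
Lemma wev_weight w : size w != (worder w).+1 -> wev w = 0.
Proof.
move=> ne; suff E : blk (zeros w) (posit w) = 0 by rewrite /wev E scaler0.
move: ne; rewrite size_zeros_posit worder_posit -addSn eqn_add2r.
elim: (posit w) (zeros w) => [|[b n] P IH] Z ne.
  by case: Z ne => [|x [|y Z]].
case: (leqP (size Z) n) => [le|/split_size [Z1 [Z2 [eZ sZ]]]].
  by rewrite blk_small.
rewrite eZ blk_cat // IH ?scaler0 //=; move: ne.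
by rewrite eZ size_cat sZ /worder /= addSn !eqSS eqn_add2l.
Qed.

(** The transpose of [D]: [G] composed with the even derivation that raises one exponent by one. *)
Fixpoint wder (G : seq letter -> A) w : A :=
  match w with
  | [::] => 0
  | (h, n) :: w' => G ((h, n.+1) :: w') + wder (fun v => G ((h, n) :: v)) w'
  end.

Lemma eq_wder G G' w :
  (forall v, wpar v = wpar w -> size v = size w -> worder v = (worder w).+1 ->
    G v = G' v) -> wder G w = wder G' w.
Proof.
elim: w G G' => [|[h n] w IH] G G' E //=; rewrite E //; congr (_ + _).
apply: IH => v e1 e2 e3; rewrite E //= ?e1 ?e2 //.
by rewrite /worder /= -/(worder v) e3 addnS.
Qed.

Lemma wder_scale k G w : wder (fun v => k *: G v) w = k *: wder G w.
Proof.
elim: w G => [|[h n] w IH] G /=; first by rewrite scaler0.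
by rewrite (IH (fun v => G ((h, n) :: v))) scalerDr.
Qed.

Lemma wder_add G G' w : wder (fun v => G v + G' v) w = wder G w + wder G' w.
Proof.
elim: w G G' => [|[h n] w IH] G G' /=; first by rewrite addr0.
by rewrite (IH (fun v => G ((h, n) :: v))) addrACA.
Qed.

Lemma wder0 w : wder (fun=> 0) w = 0.
Proof. by elim: w => [|[h n] w IH] //=; rewrite IH addr0. Qed.

Lemma wder_cat G u v : wder G (u ++ v) =
  wder (fun w => G (w ++ v)) u + wder (fun w => G (u ++ w)) v.
Proof.
elim: u G => [|[h n] u IH] G /=; first by rewrite add0r.
by rewrite IH addrA.
Qed.

Lemma wder_gm (y : A) G w : wder (fun v => gm y (G v)) w = gm y (wder G w).
Proof.
elim: w G => [|[h n] w IH] G /=; first by rewrite gm0r.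
by rewrite (IH (fun v => G ((h, n) :: v))) gmAr.
Qed.

Lemma ssym_ctx u v G : ssym lp G -> ssym lp (fun w => G (u ++ w ++ v)).
Proof. by move=> sG U x t V; rewrite -!catA !cat_cons catA sG -catA. Qed.

Lemma wder_ssym G : ssym lp G -> ssym lp (wder G).
Proof.
move=> sG U [h n] [k m] V; rewrite !wder_cat /= scalerDr; congr (_ + _).
  by rewrite -wder_scale; apply: eq_wder => w _ _ _; rewrite (sG w).
rewrite !scalerDr (sG U (h, n.+1) (k, m)) (sG U (h, n) (k, m.+1)) addrCA.
congr (_ + (_ + _)).
rewrite -wder_scale; apply: eq_wder => w _ _ _.
by rewrite sG.
Qed.

(** Since [G] reads the product of [x] and [t] as x t', letting [x] act on the zeros [Z] amounts to
    multiplying the derivative of [Z] by [x]; supersymmetry moves [x] to the front. *)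
Lemma dv_wder G x (Z : seq hel) R : ssym lp G ->
  (forall U t V, G (U ++ (hmul x t, 0%N) :: V) = G (U ++ (x, 0%N) :: (t, 1%N) :: V)) ->
  dv x (fun Y => G (zw Y ++ R)) Z = wder (fun u => G ((x, 0%N) :: u ++ R)) (zw Z).
Proof.
elim: Z G => [|u Z IH] G sG mG //=; rewrite (mG [::]) /=; congr (_ + _).
rewrite (IH (fun w => G ((u, 0%N) :: w))).
- rewrite -wder_scale; apply: eq_wder => w _ _ _.
  by have := sG [::] (x, 0%N) (u, 0%N); rewrite /= => ->.
- by move=> U y t V; apply: (sG (_ :: U)).
- by move=> U t V; apply: (mG (_ :: U)).
Qed.

Lemma ssym_sort G w : ssym lp G ->
  G w = sortsgn w *: G (zw (zeros w) ++ [seq (l.1, l.2.+1) | l <- posit w]).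
Proof.
elim: w G => [|[h [|n]] w IH] G sG /=; first by rewrite scale1r.
  by rewrite (IH (fun v => G ((h, 0%N) :: v))) // => U x t V; apply: (sG (_ :: U)).
rewrite (IH (fun v => G ((h, n.+1) :: v))); last by move=> U x t V; apply: (sG (_ :: U)).
have := ssym_letter sG [::] (h, n.+1) (zw (zeros w)).
rewrite /= => ->; rewrite scalerA mulrC; congr (_ * _ *: _).
by rewrite wpar_zw.
Qed.

Lemma wev1 x : wev [:: (x, 0%N)] = hv x.
Proof. by rewrite /wev /= scale1r. Qed.

(** Deriving the uncontracted block gives Z' b^(n+1) + Z b^(n+2). After multiplication by [c] this
    is the product of [c] with the brace, by [br_cons] read backwards, so deriving before or after
    the contraction agrees. *)
Lemma wev_gm_step c (Z : seq hel) b n v : size Z = n.+1 ->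
  wder (fun w => wev ((c, 0%N) :: w)) ((bh b Z, 0%N) :: v) =
    gm (hv c) (wev ((bh b Z, 0%N) :: v)) ->
  wder (fun w => wev ((c, 0%N) :: w)) (zw Z ++ (b, n.+1) :: v) =
    gm (hv c) (wev (zw Z ++ (b, n.+1) :: v)).
Proof.
move=> sZ; rewrite wev_contract0 // => <-; rewrite wder_cat /= addrA.
congr (_ + _); last first.
  by apply: eq_wder => w _ _ _; have /= := @wev_contract [:: (c, 0%N)] Z b n w sZ.
have lK : hlin (fun h => wev ((h, 0%N) :: v)) by apply: (@wev_mlin [::]).
have /= <- := @wev_mul [::] c (bh b Z) v.
have dP : gh (hp c (+) par Z (+) hp b) (dv c (br b) Z).
  by apply: gh_dv => U _ <-; apply: gh_br.
rewrite (lK 1 (bh b (c :: Z)) (Hel dP) (hmul c (bh b Z))) /=; last first.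
- by rewrite br_cons scale1r subrK.
- by rewrite addbA.
- by rewrite addbA.
rewrite scale1r addrC; congr (_ + _).
  by rewrite -(@wev_contract0 (c :: Z) b n.+1) //= sZ.
rewrite (dv_pack (G := br b) (gH := bh b) (p := hp b) (x := c) (T := Z) lK) //.
rewrite (eq_dv (G' := fun Y : seq hel => wev (zw Y ++ (b, n.+1) :: v))); last first.
  by move=> U sU _; rewrite wev_contract0 ?sU.
by rewrite (@dv_wder wev c Z ((b, n.+1) :: v) wev_ssym) // => ? ? ?; rewrite wev_mul.
Qed.

(** The identity c D(w) = c o w. Both sides are supersymmetric in [w], so [w] may be sorted; one
    contraction then shortens it. *)
Lemma wev_gm c w :
  wder (fun v => wev ((c, 0%N) :: v)) w = gm (hv c) (wev w).
Proof.
pose f := wder (fun v => wev ((c, 0%N) :: v)); pose g v := gm (hv c) (wev v).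
have sf : ssym lp f.
  by apply: wder_ssym => U x t V; apply: (@wev_ssym (_ :: U)).
have sg : ssym lp g by move=> U x t V; rewrite /g wev_ssym gmZr.
rewrite -[LHS]/(f w) -[RHS]/(g w).
have [m] := ubnP (size w); elim: m w => // m IH w; rewrite ltnS => lew.
(* Off weight both sides vanish: multiplying by [c] and deriving once adds 1 to the length and to
   the order. *)
have [ew|ne] := eqVneq (size w) (worder w).+1; last first.
  rewrite /f /g wev_weight // gm0r -[RHS](wder0 w).
  apply: eq_wder => v _ sv ov; apply: wev_weight.
  by rewrite /worder /= -/(worder v) sv ov eqSS.
rewrite (ssym_sort _ sf) (ssym_sort _ sg); congr (_ *: _).
have : (size (zeros w) + size (posit w) = (worder (posit w) + size (posit w)).+1)%N.
  by rewrite -size_zeros_posit -worder_posit.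
move: lew; rewrite size_zeros_posit.
case: (posit w) (zeros w) => [|[b n] P] Z /= lew.
  rewrite cats0; case: Z lew => [|z [|y Z]] // _ _.
  rewrite /f /g /= addr0 wev1.
  by have /= <- := @wev_mul [::] c z [::]; rewrite wev1.
rewrite /worder /= -/(worder P) -addSnnS => eZ.
have : (n.+1 <= size Z)%N by move: eZ => /eqP; rewrite addSnnS; lia.
case/split_size => Z1 [Z2 [EZ sZ]]; rewrite EZ /zw map_cat -!/(zw _) -catA.
set v := map _ P.
rewrite (ssym_letterV sf (zw Z1)) (ssym_letterV sg (zw Z1)); congr (_ *: _).
apply: wev_gm_step => //; apply: (IH ((bh b Z1, 0%N) :: zw Z2 ++ v)); move: lew.
by rewrite EZ /= !size_cat !size_map sZ; lia.
Qed.

Lemma eq_iter_wder G G' n w :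
  (forall v, wpar v = wpar w -> size v = size w -> worder v = (n + worder w)%N ->
    G v = G' v) -> iter n wder G w = iter n wder G' w.
Proof.
elim: n w => [|n IH] w E /=; first exact: E.
apply: eq_wder => v e1 e2 e3; apply: IH => u f1 f2 f3.
by rewrite E ?f1 ?f2 // f3 e3 addnS.
Qed.

Lemma iter_wder_scale n k G w :
  iter n wder (fun v => k *: G v) w = k *: iter n wder G w.
Proof.
elim: n w => //= n IH w; rewrite -wder_scale.
by apply: eq_wder => v _ _ _; apply: IH.
Qed.

Lemma iter_wder_add n G G' w :
  iter n wder (fun v => G v + G' v) w = iter n wder G w + iter n wder G' w.
Proof.
elim: n w => //= n IH w; rewrite -wder_add.
by apply: eq_wder => v _ _ _; apply: IH.
Qed.

Lemma iter_wder_gm n (y : A) G w :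
  iter n wder (fun v => gm y (G v)) w = gm y (iter n wder G w).
Proof.
elim: n w => //= n IH w; rewrite -wder_gm.
by apply: eq_wder => v _ _ _; apply: IH.
Qed.

Lemma iter_wder0 n w : iter n wder (fun=> 0) w = 0.
Proof.
elim: n w => //= n IH w; rewrite -[RHS](wder0 w).
by apply: eq_wder => v _ _ _; apply: IH.
Qed.

Lemma iter_wder_comm n (K : seq letter -> seq letter -> A) u v :
  iter n wder (fun w => wder (K w) v) u = wder (fun w => iter n wder (K^~ w) u) v.
Proof.
elim: v K => [|[h m] v IH] K /=; first exact: iter_wder0.
by rewrite (iter_wder_add _ (fun w => K w _)) (IH (fun w w' => K w ((h, m) :: w'))).
Qed.

Lemma zero_letter v : (worder v < size v)%N ->
  exists V1 c V2, v = V1 ++ (c, 0%N) :: V2.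
Proof.
elim: v => // -[h [|n]] v IH /=; first by exists [::], h, v.
rewrite /worder /= -/(worder v) => lt.
have /IH [V1 [c [V2 ->]]] : (worder v < size v)%N by lia.
by exists ((h, n.+1) :: V1), c, V2.
Qed.

(** Induction on n for all [v]: a letter [c] without derivative is taken from [v], and [wev_gm]
    trades one derivative of the first letter for a product with [c] and a derivative of the
    rest. *)
Lemma wev_leib0 n a b v : wev ((hmul a b, n) :: v) =
  iter n wder (fun w => wev (w ++ v)) [:: (a, 0%N); (b, 1%N)].
Proof.
elim: n v => [|n IH] v; first exact: (@wev_mul [::]).
set w0 := [:: _; _] in IH *.
have [ew|ne] := eqVneq (size v) (n.+1 + worder v)%N; last first.
  rewrite wev_weight; last by rewrite /worder /= -/(worder v) eqSS.
  rewrite -[LHS](iter_wder0 n.+1 w0); apply: eq_iter_wder => w _ sw ow.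
  rewrite wev_weight // size_cat /worder map_cat sumn_cat -!/(worder _) sw ow.
  by rewrite /= /worder /= -/(worder v); apply: contra ne => /eqP e; apply/eqP; lia.
(* On weight, [v] has more letters than derivatives, hence a letter without derivative. *)
have /zero_letter [V1 [c [V2 ->]]] : (worder v < size v)%N by lia.
pose k := s (hp c) (hp a (+) hp b (+) wpar V1).
have E w : wpar w = hp a (+) hp b ->
    wev (w ++ V1 ++ (c, 0%N) :: V2) = k *: wev ((c, 0%N) :: w ++ (V1 ++ V2)).
  move=> pw; have := ssym_letterV wev_ssym [::] (c, 0%N) (w ++ V1) V2.
  by rewrite /= par_cat pw -!catA.
rewrite (E [:: (_, _)]); last by rewrite /= addbF.
rewrite (eq_iter_wder (G' := fun w => k *: wev ((c, 0%N) :: w ++ (V1 ++ V2)))); last first.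
  by move=> w pw _ _; rewrite E // pw /= /lp /= addbF.
rewrite (iter_wder_scale _ _ (fun w => wev ((c, 0%N) :: w ++ (V1 ++ V2)))).
congr (_ *: _); move: (V1 ++ V2) => {k E ew V1 V2 v} v.
rewrite iterSr.
(* This is c D(w) v = c D(w v) - c w D(v), with [wev_gm] applied to the first term. *)
rewrite (eq_iter_wder (G' := fun w => gm (hv c) (wev (w ++ v)) +
    (-1) *: wder (fun u => wev ((c, 0%N) :: w ++ u)) v)); last first.
  by move=> w _ _ _; rewrite scaleN1r -wev_gm wder_cat addrK.
rewrite (iter_wder_add _ (fun w => gm (hv c) (wev (w ++ v)))).
rewrite (iter_wder_gm _ _ (fun w => wev (w ++ v))) -IH -wev_gm /=.
rewrite (iter_wder_scale _ _ (fun w => wder (fun u => wev ((c, 0%N) :: w ++ u)) v)).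
rewrite (iter_wder_comm _ (fun w u => wev ((c, 0%N) :: w ++ u))) scaleN1r.
rewrite -addrA -[LHS]addr0; congr (_ + _); apply/esym/eqP; rewrite subr_eq0; apply/eqP.
apply: eq_wder => u _ _ _.
(* Moving [c] behind [w] turns [(c, 0) :: u] into a context to which the induction hypothesis
   applies. *)
have E w : wpar w = hp a (+) hp b ->
    wev ((c, 0%N) :: w ++ u) = s (hp c) (hp a (+) hp b) *: wev (w ++ (c, 0%N) :: u).
  by move=> pw; have := ssym_letter wev_ssym [::] (c, 0%N) w u; rewrite /= pw.
rewrite (E [:: (_, _)]) /= ?addbF // IH -iter_wder_scale.
by apply: eq_iter_wder => w pw _ _; rewrite E // pw /= /lp /= addbF.
Qed.

Lemma wev_leib n U a b V : wev (U ++ (hmul a b, n) :: V) =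
  iter n wder (fun w => wev (U ++ w ++ V)) [:: (a, 0%N); (b, 1%N)].
Proof.
set w0 := [:: _; _].
rewrite (eq_iter_wder (G' := fun w => s (wpar U) (hp a (+) hp b) *: wev (w ++ U ++ V))).
  rewrite (iter_wder_scale _ _ (fun w => wev (w ++ U ++ V))) -wev_leib0.
  by have /= -> := ssym_block wev_ssym [::] U [:: (hmul a b, n)] V; rewrite /= addbF.
move=> w pw _ _; have /= -> := ssym_block wev_ssym [::] U w V.
by rewrite pw /= /lp /= addbF.
Qed.

End Value.

(** * Evaluation of differential terms *)

Section Evaluation.
Variables (F : fieldType) (A : gdnSuper F).
Local Notation letter := (letter A).
Local Notation lp := (@lp F A).
Local Notation wpar := (parity lp).
Implicit Types (U V u w v : seq letter) (G : seq letter -> A).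

(* Functionals on words that factor through the algebra generated by A, in
   which the word (a o b, n) equals the n-th derivative of a b'. *)
Record good G : Prop := Good {
  good_ssym : ssym lp G;
  good_mlin : wmlin G;
  good_leib : forall n U a b V, G (U ++ (hmul a b, n) :: V) =
    iter n (@wder F A) (fun w => G (U ++ w ++ V)) [:: (a, 0%N); (b, 1%N)] }.

Lemma good_wev : good (@wev F A).
Proof. by split; [apply: wev_ssym|apply: wev_mlin|apply: wev_leib]. Qed.

Lemma good_ctx u v G : good G -> good (fun w => G (u ++ w ++ v)).
Proof.
case=> sG lG mG; split; first exact: ssym_ctx.
  by move=> U V n; have := lG (u ++ U) (V ++ v) n; rewrite /hlin /= => H k h1 h2 h;
    rewrite -!catA !cat_cons !catA -!catA; have := H k h1 h2 h; rewrite -!catA.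
move=> n U a b V; have := mG n (u ++ U) a b (V ++ v); rewrite -!catA /= => ->.
by apply: eq_iter_wder => w _ _ _; rewrite -!catA.
Qed.

Lemma good_comb k G G' : good G -> good G' -> good (fun w => k *: G w + G' w).
Proof.
case=> sG lG mG [sG' lG' mG']; split=> [U x t V|U V n l h1 h2 h e1 e2 e|n U a b V].
- by rewrite sG sG' scalerDr !scalerA mulrC.
- rewrite (lG U V n l h1 h2 h) // (lG' U V n l h1 h2 h) //.
  by rewrite !scalerDr !scalerA [_ * k]mulrC addrACA.
- rewrite mG mG' (iter_wder_add _ (fun w => k *: G (U ++ w ++ V))).
  by rewrite (iter_wder_scale _ _ (fun w => G (U ++ w ++ V))).
Qed.

Lemma good0 : good (fun=> 0).
Proof.
split=> [U x t V|U V n k h1 h2 h _ _ _|n U a b V].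
- by rewrite scaler0.
- by rewrite scaler0 addr0.
- by rewrite iter_wder0.
Qed.

Lemma good_add G G' : good G -> good G' -> good (fun w => G w + G' w).
Proof.
move=> gG gG'; have := good_comb 1 gG gG'; congr good.
by apply: funext => w; rewrite scale1r.
Qed.

Lemma good_scale k G : good G -> good (fun w => k *: G w).
Proof.
move=> gG; have := good_comb k gG good0; congr good.
by apply: funext => w; rewrite addr0.
Qed.

Lemma good_wder_param (K : seq letter -> seq letter -> A) v :
  (forall v, good (K^~ v)) -> good (fun u => wder (K u) v).
Proof.
elim: v K => [|[h n] v IH] K gK /=; first exact: good0.
by apply: good_add => //; apply: (IH (fun u w => K u ((h, n) :: w))).
Qed.

(** The derivative hits [U], the product letter or [V]. The middle term is the Leibniz property for
    n + 1, the outer ones are that for n in a differentiated context. *)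
Lemma good_wder G : good G -> good (@wder F A G).
Proof.
case=> sG lG mG; split=> [|U V n k h1 h2 h e1 e2 e|n U a b V].
- exact: wder_ssym.
- rewrite !wder_cat /=.
  rewrite (lG U V n.+1 k h1 h2 h) //.
  rewrite (eq_wder (w := U) (G' := fun w =>
    k *: G (w ++ (h1, n) :: V) + G (w ++ (h2, n) :: V))); last first.
    by move=> w _ _ _; apply: lG.
  rewrite (eq_wder (w := V) (G' := fun w =>
    k *: G (U ++ (h1, n) :: w) + G (U ++ (h2, n) :: w))); last first.
    by move=> w _ _ _; apply: lG.
  rewrite (wder_add (fun w => k *: G (w ++ (h1, n) :: V))).
  rewrite (wder_add (fun w => k *: G (U ++ (h1, n) :: w))).
  rewrite (wder_scale _ (fun w => G (w ++ (h1, n) :: V))).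
  rewrite (wder_scale _ (fun w => G (U ++ (h1, n) :: w))).
  rewrite !scalerDr.
  by rewrite [RHS](AC ((1*2)*(1*2)) ((1*4)*((2*5)*(3*6)))) /=.
- rewrite wder_cat /= (mG n.+1) iterSr.
  rewrite (eq_iter_wder (G := fun w => wder G (U ++ w ++ V))
    (G' := fun w => wder (fun u => G (u ++ w ++ V)) U +
     (wder (fun w => G (U ++ w ++ V)) w + wder (fun v => G (U ++ w ++ v)) V))); last first.
    by move=> w _ _ _; rewrite !wder_cat.
  rewrite (iter_wder_add _ (fun w => wder (fun u => G (u ++ w ++ V)) U)).
  rewrite (iter_wder_add _ (wder (fun w => G (U ++ w ++ V)))).
  rewrite (iter_wder_comm _ (fun w u => G (u ++ w ++ V))).
  rewrite (iter_wder_comm _ (fun w v => G (U ++ w ++ v))).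
  by congr (_ + (_ + _)); apply: eq_wder => w _ _ _; apply: mG.
Qed.

Variables (X : Type) (px : X -> bool) (iota : X -> hel A).
Hypothesis hp_iota : forall x, hp (iota x) = px x.
Implicit Types (d : dterm F X).

(** The linear extension of [G] applied to the polynomial denoted by [d], in continuation style: a
    product nests functionals and [D] acts through its transpose, so polynomials need no normal
    form. *)
Fixpoint ev d G : A :=
  match d with
  | dvar x => G [:: (iota x, 0%N)]
  | dzero => 0
  | dadd a b => ev a G + ev b G
  | dscale k a => k *: ev a G
  | dmul a b => ev a (fun u => ev b (fun v => G (u ++ v)))
  | dD a => ev a (@wder F A G)
  end.

Lemma wder_fadd G G' : wder (fun w => G w + G' w) = (fun w => wder G w + wder G' w).
Proof. by apply: funext => w; apply: wder_add. Qed.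

Lemma wder_fscale k G : wder (fun w => k *: G w) = (fun w => k *: wder G w).
Proof. by apply: funext => w; apply: wder_scale. Qed.

Lemma ev_add d G G' : ev d (fun w => G w + G' w) = ev d G + ev d G'.
Proof.
elim: d G G' => [x||a IHa b IHb|k a IHa|a IHa b IHb|a IHa] G G' //=.
- by rewrite addr0.
- by rewrite IHa IHb addrACA.
- by rewrite IHa scalerDr.
- by rewrite -IHa; congr (ev a _); apply: funext => u; rewrite -IHb.
- by rewrite wder_fadd IHa.
Qed.

Lemma ev_scale d k G : ev d (fun w => k *: G w) = k *: ev d G.
Proof.
elim: d G => [x||a IHa b IHb|l a IHa|a IHa b IHb|a IHa] G //=.
- by rewrite scaler0.
- by rewrite IHa IHb scalerDr.
- by rewrite IHa !scalerA mulrC.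
- by rewrite -IHa; congr (ev a _); apply: funext => u; rewrite -IHb.
- by rewrite wder_fscale IHa.
Qed.

Lemma ev0 d : ev d (fun=> 0) = 0.
Proof.
by have := ev_scale d 0 (fun=> 0); rewrite !scale0r.
Qed.

Lemma wder_ev d (K : seq letter -> seq letter -> A) u :
  wder (fun u => ev d (K u)) u = ev d (fun v => wder (K^~ v) u).
Proof.
elim: u K => [|[h n] u IH] K /=; first by rewrite ev0.
by rewrite (IH (fun u => K ((h, n) :: u))) -ev_add.
Qed.

Lemma ev_swap a b (K : seq letter -> seq letter -> A) :
  ev a (fun u => ev b (K u)) = ev b (fun v => ev a (K^~ v)).
Proof.
elim: a K => [x||a1 IH1 a2 IH2|k a IHa|a1 IH1 a2 IH2|a IHa] K //=.
- by rewrite ev0.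
- by rewrite IH1 IH2 -ev_add.
- by rewrite IHa -ev_scale.
- rewrite -IH1; congr (ev a1 _); apply: funext => u.
  exact: (IH2 (fun v => K (u ++ v))).
- by rewrite -IHa; congr (ev a _); apply: funext => u; rewrite wder_ev.
Qed.

(** A homogeneous term expands into words of its own parity, which gives the Koszul sign in
    [de_mulC] a definite value on words. *)
Lemma eq_ev_hom d p G G' : dhom px d p ->
  (forall w, wpar w = p -> G w = G' w) -> ev d G = ev d G'.
Proof.
move=> hd; elim: hd G G' => {d p}
  [x|b|a c b _ IHa _ IHc|k a b _ IHa|a c i j _ IHa _ IHc|a b _ IHa] G G' E //=.
- by rewrite E //= /lp /= addbF.
- by rewrite (IHa G G') // (IHc G G').
- by rewrite (IHa G G').
- apply: IHa => u pu; apply: IHc => v pv; apply: E.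
  by rewrite par_cat pu pv.
- by apply: IHa => w pw; apply: eq_wder => v pv _ _; apply: E; rewrite pv.
Qed.

Lemma good_ev d (K : seq letter -> seq letter -> A) :
  (forall v, good (K^~ v)) -> good (fun u => ev d (K u)).
Proof.
elim: d K => [x||a IHa b IHb|k a IHa|a IHa b IHb|a IHa] K gK //=.
- exact: good0.
- by apply: good_add; [apply: IHa|apply: IHb].
- by apply: good_scale; apply: IHa.
- apply: (IHa (fun u v => ev b (fun v' => K u (v ++ v')))) => v.
  exact: (IHb (fun u v' => K u (v ++ v'))).
- by apply: (IHa (fun u => wder (K u))) => v; apply: good_wder_param.
Qed.

Lemma good_left u G : good G -> good (fun w => G (u ++ w)).
Proof.
by move=> gG; have := good_ctx u [::] gG; congr good; apply: funext => w; rewrite cats0.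
Qed.

Lemma good_right v G : good G -> good (fun w => G (w ++ v)).
Proof. exact: (good_ctx [::]). Qed.

Lemma good_ev_right d G : good G -> good (fun u => ev d (fun v => G (u ++ v))).
Proof. by move=> gG; apply: good_ev => v; apply: good_right. Qed.

Lemma ev_sound a b G : kd_eq px a b -> good G -> ev a G = ev b G.
Proof.
move=> ab; elim: ab G => {a b} /=.
- by [].
- by move=> a b _ IH G /IH.
- by move=> a b c _ IH1 _ IH2 G gG; rewrite IH1 ?IH2.
- by move=> a a' b b' _ IHa _ IHb G gG; rewrite IHa ?IHb.
- by move=> k a a' _ IHa G gG; rewrite IHa.
- move=> a a' b b' _ IHa _ IHb G gG; rewrite IHa; last exact: good_ev_right.
  by congr (ev a' _); apply: funext => u; apply: IHb; apply: good_left.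
- by move=> a a' _ IHa G gG; apply: IHa; apply: good_wder.
- by move=> a b c G _; rewrite addrA.
- by move=> a b G _; rewrite addrC.
- by move=> a G _; rewrite add0r.
- by move=> a G _; rewrite scaleN1r addrN.
- by move=> a G _; rewrite scale1r.
- by move=> k l a G _; rewrite scalerA.
- by move=> k l a G _; rewrite scalerDl.
- by move=> k a b G _; rewrite scalerDr.
- by [].
- by move=> a b c G _; rewrite -ev_add.
- by [].
- by move=> k a b G _; rewrite -ev_scale; congr (ev a _); apply: funext => u; rewrite -ev_scale.
- move=> a b c G _; congr (ev a _); apply: funext => u; congr (ev b _); apply: funext => v.
  by congr (ev c _); apply: funext => w; rewrite catA.
(* Supercommutativity: [ev_swap] exchanges the order of expansion, and the symmetry of [G] exchanges
   the two words. *)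
- move=> x y i j hx hy G gG; rewrite ev_swap -ev_scale.
  apply: (eq_ev_hom hy) => v pv; rewrite -ev_scale; apply: (eq_ev_hom hx) => u pu.
  by have := ssym_block (good_ssym gG) [::] u v [::]; rewrite !cats0 pu pv.
- by [].
- by [].
- move=> a b G _; rewrite -ev_add; congr (ev a _); apply: funext => u.
  rewrite wder_ev -ev_add; congr (ev b _); apply: funext => v.
  exact: wder_cat.
Qed.

(** Multiplication and [D] on ideal elements are absorbed into the functional, which stays good;
    hence the quantification over all good [G]. *)
Lemma ev_dideal (T : dterm F X -> Prop) :
  (forall d, T d -> forall G, good G -> ev d G = 0) ->
  forall d, dideal px T d -> forall G, good G -> ev d G = 0.
Proof.
move=> T0 d; elim=> {d} /=.
- exact: T0.
- by [].
- by move=> a b _ IHa _ IHb G gG; rewrite IHa ?IHb ?addr0.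
- by move=> k a _ IHa G gG; rewrite IHa ?scaler0.
- move=> a t _ IHt G gG; rewrite -[RHS](ev0 a); congr (ev a _).
  by apply: funext => u; apply: IHt; apply: good_left.
- by move=> t a _ IHt G gG; apply: IHt; apply: good_ev_right.
- by move=> t _ IHt G gG; apply: IHt; apply: good_wder.
- by move=> t t' e _ IHt G gG; rewrite -(ev_sound e) ?IHt.
Qed.

Variable cls : gterm F X -> A.
Hypothesis cls_var : forall x, cls (gvar F x) = hv (iota x).
Hypothesis cls_zero : cls (gzero F X) = 0.
Hypothesis cls_add : forall a b, cls (gadd a b) = cls a + cls b.
Hypothesis cls_scale : forall k a, cls (gscale k a) = k *: cls a.
Hypothesis cls_mul : forall a b, cls (gmul a b) = gm (cls a) (cls b).

(** To every good functional, the image of a homogeneous term looks like one letter. Products use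
    [good_leib] at n = 0; larger n make that property stable under [wder]. *)
Lemma ev_phi_hom t p : ghom px t p -> exists h : hel A,
  [/\ hv h = cls t, hp h = p & forall G, good G -> ev (phi t) G = G [:: (h, 0%N)]].
Proof.
elim=> {t p} [x|b|a c b _ [h [e1 e2 E]] _ [h' [e1' e2' E']]|k a b _ [h [e1 e2 E]]
  |a c i j _ [h [e1 e2 E]] _ [h' [e1' e2' E']]] /=.
- by exists (iota x); rewrite cls_var.
- exists (Hel (gh0 A b)); split=> // G gG.
  by rewrite (hlin0 (@good_mlin _ gG [::] [::] 0%N)).
- have ph : gh b (hv h + hv h').
    apply: ghA; first by rewrite -e2; apply: hP.
    by rewrite -e2'; apply: hP.
  exists (Hel ph); split=> [||G gG] //=; first by rewrite cls_add e1 e1'.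
  have lG : hlin (fun h => G [:: (h, 0%N)]) by exact: (@good_mlin _ gG [::] [::] 0%N).
  by rewrite E // E' // (lG 1 h h' (Hel ph)) ?scale1r.
- have ph : gh b (k *: hv h) by apply: ghZ; rewrite -e2; apply: hP.
  exists (Hel ph); split=> [||G gG] //=; first by rewrite cls_scale e1.
  have lG : hlin (fun h => G [:: (h, 0%N)]) by exact: (@good_mlin _ gG [::] [::] 0%N).
  by rewrite E // (hlinZ (k := k) (h := h) (h' := Hel ph) lG).
- exists (hmul h h'); split=> [||G gG] //=; first by rewrite cls_mul e1 e1'.
    by rewrite e2 e2'.
  have -> : (fun u => ev (phi c) (wder (fun v => G (u ++ v)))) =
            (fun u => G (u ++ [:: (h', 1%N)])).
    by apply: funext => u; rewrite E' /= ?addr0 //; apply/good_wder/good_left.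
  rewrite E; last exact: good_right.
  by have := @good_leib _ gG 0 [::] h h' [::].
Qed.

End Evaluation.

(** * The homomorphism phi *)

Section PhiSound.
Variables (F : fieldType) (X : Type) (px : X -> bool).
Implicit Types (a b c x y z : dterm F X).
Local Notation "a == b" := (kd_eq px a b).

(** The two terms x y' z' cancel. What is left of the associator is supersymmetric in [x] and [y],
    whence left symmetry. *)
Lemma kd_assoc_part x y z :
  dsub (dcirc x (dcirc y z)) (dcirc (dcirc x y) z) == dmul (dmul x y) (dD (dD z)).
Proof.
rewrite /dsub /dcirc; set dy := dD y; set dz := dD z; set w := dmul (dmul x dy) dz.
apply: (de_trans (b := dadd (dadd w (dmul (dmul x y) (dD dz))) (dscale (-1) w))).
  apply: de_add (de_refl _ _).
  apply: de_trans (de_mul (de_refl _ _) (de_DM _ _ _)) _.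
  apply: de_trans (de_mulDr _ _ _ _) _.
  by apply: de_add; apply: de_mulA.
apply: de_trans (de_add (de_addC _ _ _) (de_refl _ _)) _.
apply: de_trans (de_sym (de_addA _ _ _ _)) _.
apply: de_trans (de_add (de_refl _ _) (de_addN _ _)) _.
exact: de_trans (de_addC _ _ _) (de_add0 _ _).
Qed.

Lemma phi_hom (t : gterm F X) p : ghom px t p -> dhom px (phi t) p.
Proof.
elim=> {t p} /=; try by constructor.
by move=> a c i j _ Ha _ Hc; apply: dh_mul Ha (dh_D Hc).
Qed.

Lemma phi_sound (a b : gterm F X) : gdn_eq px a b -> phi a == phi b.
Proof.
elim=> {a b} /=; try by constructor.
- by move=> a b c _ ab _; apply: de_trans.
- by move=> a a' b b' _ aa _ bb; apply: de_mul aa (de_D bb).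
- by move=> a b c; apply: de_trans (de_mul (de_refl _ _) (de_DD _ _ _)) (de_mulDr _ _ _ _).
- by move=> k a b; apply: de_trans (de_mul (de_refl _ _) (de_DZ _ _ _)) (de_mulZr _ _ _ _).
- move=> x y z i j l hx hy hz.
  apply: de_trans (kd_assoc_part _ _ _) _.
  apply: de_trans (de_mul (de_mulC (phi_hom hx) (phi_hom hy)) (de_refl _ _)) _.
  apply: de_trans (de_mulZl _ _ _ _) _.
  exact/de_scale/de_sym/kd_assoc_part.
- move=> x y z i j l hx hy hz.
  apply: de_trans (de_sym (de_mulA _ _ _ _)) _.
  apply: de_trans (de_mul (de_refl _ _) (de_mulC (dh_D (phi_hom hy)) (dh_D (phi_hom hz)))) _.
  apply: de_trans (de_mulZr _ _ _ _) _.
  exact/de_scale/de_mulA.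
Qed.

Lemma phi_gideal (S : gterm F X -> Prop) t :
  gideal px S t -> dideal px (phi_set S) (phi t).
Proof.
elim=> {t} /=.
- by move=> t St; apply: di_gen; exists t.
- exact: di_zero.
- by move=> a b _ Ia _ Ib; apply: di_add.
- by move=> k a _ Ia; apply: di_scale.
(* Left multiplication by [a] becomes a D(t), so closure under [D] is used here. *)
- by move=> a t _ It; apply/di_mull/di_D.
- by move=> t a _ It; apply: di_mulr.
- by move=> t t' e _; apply: di_eq (phi_sound e).
Qed.

Lemma dquot_refl (T : dterm F X -> Prop) d : dquot px T d d.
Proof. by apply: di_eq (de_sym (de_addN _ _)) (di_zero _ _). Qed.

End PhiSound.

HB.instance Definition _ (F : fieldType) (X : Type) := gen_eqMixin (gterm F X).
HB.instance Definition _ (F : fieldType) (X : Type) := gen_choiceMixin (gterm F X).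

(** The module structure is built once for any such congruence, then used for [gdn_eq] and for
    [gquot]. *)
Record lcong (F : fieldType) (X : Type) (px : X -> bool) := Lcong {
  lc : gterm F X -> gterm F X -> Prop;
  lc_sym : forall a b, lc a b -> lc b a;
  lc_trans : forall a b c, lc a b -> lc b c -> lc a c;
  lc_add : forall a a' b b', lc a a' -> lc b b' -> lc (gadd a b) (gadd a' b');
  lc_scale : forall k a a', lc a a' -> lc (gscale k a) (gscale k a');
  lc_gdn : forall a b, gdn_eq px a b -> lc a b }.

(** * Quotients of the term algebra *)

Section Quotient.
Variables (F : fieldType) (X : Type) (px : X -> bool) (R : lcong F px).
Implicit Types (a b c : gterm F X) (k l : F).

Definition lcb a b : bool := `[< lc R a b >].

Lemma lcb_equiv : equiv_class_of lcb.
Proof.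
split=> [a|a b|b a c].
- by apply/asboolP/lc_gdn/ge_refl.
- by apply/asboolP/asboolP => /lc_sym.
- by move=> /asboolP ab /asboolP bc; apply/asboolP/(lc_trans ab bc).
Qed.

Canonical lcb_equivRel := EquivRelPack lcb_equiv.

Definition quot := {eq_quot lcb_equivRel}%qT.
HB.instance Definition _ := Choice.on quot.

Definition cl a : quot := (\pi_quot a)%qT.
Definition rep (x : quot) : gterm F X := repr x.

Lemma cl_rep x : cl (rep x) = x.
Proof. exact: reprK. Qed.

Lemma clP a b : cl a = cl b <-> lc R a b.
Proof.
split; first by move/eqmodP => /asboolP.
by move=> ab; apply/eqmodP/asboolP.
Qed.

Lemma rep_cl a : lc R (rep (cl a)) a.
Proof. by apply/clP; rewrite cl_rep. Qed.

Definition qadd (x y : quot) : quot := cl (gadd (rep x) (rep y)).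
Definition qscale k (x : quot) : quot := cl (gscale k (rep x)).

Lemma clD a b : cl (gadd a b) = qadd (cl a) (cl b).
Proof. by apply/clP/lc_sym/lc_add; apply: rep_cl. Qed.

Lemma clZ k a : cl (gscale k a) = qscale k (cl a).
Proof. by apply/clP/lc_sym/lc_scale; apply: rep_cl. Qed.

Lemma cl_gdn a b : gdn_eq px a b -> cl a = cl b.
Proof. by move=> e; apply/clP/lc_gdn. Qed.

Lemma qaddA : associative qadd.
Proof.
move=> x y z; rewrite -[x]cl_rep -[y]cl_rep -[z]cl_rep -!clD.
exact/cl_gdn/ge_addA.
Qed.

Lemma qaddC : commutative qadd.
Proof. by move=> x y; rewrite -[x]cl_rep -[y]cl_rep -!clD; exact/cl_gdn/ge_addC. Qed.

Lemma qadd0 : left_id (cl (gzero F X)) qadd.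
Proof. by move=> x; rewrite -[x]cl_rep -!clD; exact/cl_gdn/ge_add0. Qed.

Lemma qaddN : left_inverse (cl (gzero F X)) (qscale (-1)) qadd.
Proof.
move=> x; rewrite qaddC -[x]cl_rep -clZ -clD.
exact/cl_gdn/ge_addN.
Qed.

HB.instance Definition _ := GRing.isZmodule.Build quot qaddA qaddC qadd0 qaddN.

Lemma qscaleA k l x : qscale k (qscale l x) = qscale (k * l) x.
Proof. by rewrite -[x]cl_rep -!clZ; exact/cl_gdn/ge_scaleM. Qed.

Lemma qscale1 : left_id 1 qscale.
Proof. by move=> x; rewrite -[x]cl_rep -!clZ; exact/cl_gdn/ge_scale1. Qed.

Lemma qscaleDr : right_distributive qscale +%R.
Proof.
move=> k x y; rewrite -[x]cl_rep -[y]cl_rep -[_ + _]clD -!clZ -[RHS]clD.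
exact/cl_gdn/ge_scaleDr.
Qed.

Lemma qscaleDl x : {morph qscale^~ x : k l / k + l}.
Proof.
move=> k l; rewrite -[x]cl_rep -!clZ -[RHS]clD.
exact/cl_gdn/ge_scaleDl.
Qed.

HB.instance Definition _ := GRing.Zmodule_isLmodule.Build F quot
  qscaleA qscale1 qscaleDr qscaleDl.

Lemma cl_add a b : cl (gadd a b) = cl a + cl b.
Proof. exact: clD. Qed.
Lemma cl_scale k a : cl (gscale k a) = k *: cl a.
Proof. exact: clZ. Qed.
Lemma cl_sub a b : cl (gsub a b) = cl a - cl b.
Proof. by rewrite /gsub cl_add cl_scale scaleN1r. Qed.
Lemma cl_zero : cl (gzero F X) = 0.
Proof. by []. Qed.

End Quotient.

(** * The quotient GDN superalgebra and injectivity *)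

Section QuotientAlgebra.
Variables (F : fieldType) (X : Type) (px : X -> bool) (S : gterm F X -> Prop).
Implicit Types (a b c t : gterm F X) (k l : F).

Definition gdn_lcong : lcong F px :=
  Lcong (@ge_sym F X px) (@ge_trans F X px) (@ge_add F X px) (@ge_scale F X px)
    (fun _ _ e => e).

Local Notation cl0 := (cl gdn_lcong).

Lemma gterm_split t : exists t0 t1,
  [/\ ghom px t0 false, ghom px t1 true & gdn_eq px t (gadd t0 t1)].
Proof.
have mDl a b c : cl0 (gmul (gadd a b) c) = cl0 (gmul a c) + cl0 (gmul b c).
  by rewrite -cl_add; apply/cl_gdn/ge_mulDl.
have mDr a b c : cl0 (gmul c (gadd a b)) = cl0 (gmul c a) + cl0 (gmul c b).
  by rewrite -cl_add; apply/cl_gdn/ge_mulDr.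
suff [t0 [t1 [h0 h1 e]]] : exists t0 t1,
    [/\ ghom px t0 false, ghom px t1 true & cl0 t = cl0 t0 + cl0 t1].
  by exists t0, t1; split=> //; move: e; rewrite -cl_add => /clP.
elim: t => [x||a [a0 [a1 [h0 h1 e]]] b [b0 [b1 [h0' h1' e']]]
  |k a [a0 [a1 [h0 h1 e]]]|a [a0 [a1 [h0 h1 e]]] b [b0 [b1 [h0' h1' e']]]].
- have hx := gh_var F px x.
  case: (px x) hx => hx.
    by exists (gzero F X), (gvar F x); split; rewrite ?cl_zero ?add0r //; apply: gh_zero.
  by exists (gvar F x), (gzero F X); split; rewrite ?cl_zero ?addr0 //; apply: gh_zero.
- by exists (gzero F X), (gzero F X); split; rewrite ?cl_zero ?addr0 //; apply: gh_zero.
- exists (gadd a0 b0), (gadd a1 b1); split; try exact: gh_add.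
  by rewrite !cl_add e e' addrACA.
- exists (gscale k a0), (gscale k a1); split; try exact: gh_scale.
  by rewrite !cl_scale e scalerDr.
- exists (gadd (gmul a0 b0) (gmul a1 b1)), (gadd (gmul a0 b1) (gmul a1 b0)); split.
  + by apply: gh_add; [apply: (gh_mul h0 h0')|apply: (gh_mul h1 h1')].
  + by apply: gh_add; [apply: (gh_mul h0 h1')|apply: (gh_mul h1 h0')].
  + move: e e'; rewrite -!cl_add => /clP e /clP e'.
    rewrite !cl_add (cl_gdn gdn_lcong (ge_mul e e')) mDl !mDr.
    by rewrite [RHS](AC (2*2) ((1*3)*(4*2))) /=.
Qed.

(** Reduces membership in the ideal to module computations in the free algebra. *)
Lemma gideal_cl t t' : gideal px S t -> cl0 t = cl0 t' -> gideal px S t'.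
Proof. by move=> It /clP e; apply: gi_eq It. Qed.

Lemma gquot_sym a b : gquot px S a b -> gquot px S b a.
Proof.
move=> /(gi_scale (-1)) /gideal_cl; apply.
by rewrite cl_scale !cl_sub scaleN1r opprB.
Qed.

Lemma gquot_trans a b c : gquot px S a b -> gquot px S b c -> gquot px S a c.
Proof.
move=> ab bc; apply: (gideal_cl (gi_add ab bc)).
by rewrite cl_add !cl_sub addrA subrK.
Qed.

Lemma gquot_add a a' b b' :
  gquot px S a a' -> gquot px S b b' -> gquot px S (gadd a b) (gadd a' b').
Proof.
move=> aa bb; apply: (gideal_cl (gi_add aa bb)).
by rewrite cl_add !cl_sub !cl_add opprD addrACA.
Qed.

Lemma gquot_scale k a a' : gquot px S a a' -> gquot px S (gscale k a) (gscale k a').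
Proof.
move=> aa; apply: (gideal_cl (gi_scale k aa)).
by rewrite cl_scale !cl_sub !cl_scale scalerBr.
Qed.

Lemma gquot_gdn a b : gdn_eq px a b -> gquot px S a b.
Proof.
move=> e; apply: (gideal_cl (gi_zero px S)).
by rewrite cl_sub (cl_gdn gdn_lcong e) subrr.
Qed.

Lemma gquot_mul a a' b b' :
  gquot px S a a' -> gquot px S b b' -> gquot px S (gmul a b) (gmul a' b').
Proof.
move=> aa bb.
(* The decomposition is a b - a' b' = (a - a') b + a' (b - b'). *)
apply: (gideal_cl (gi_add (gi_mulr b aa) (gi_mull a' bb))); rewrite cl_add.
have -> : cl0 (gmul (gsub a a') b) = cl0 (gsub (gmul a b) (gmul a' b)).
  apply: cl_gdn; apply: ge_trans (ge_mulDl _ _ _ _) _.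
  by apply: ge_add (ge_refl _ _) (ge_mulZl _ _ _ _).
have -> : cl0 (gmul a' (gsub b b')) = cl0 (gsub (gmul a' b) (gmul a' b')).
  apply: cl_gdn; apply: ge_trans (ge_mulDr _ _ _ _) _.
  by apply: ge_add (ge_refl _ _) (ge_mulZr _ _ _ _).
by rewrite !cl_sub addrA subrK.
Qed.

Definition gquot_lcong : lcong F px :=
  Lcong gquot_sym gquot_trans gquot_add gquot_scale gquot_gdn.

Local Notation A := (quot gquot_lcong).
Local Notation cls := (cl gquot_lcong).

Definition qmul (x y : A) : A := cls (gmul (rep x) (rep y)).

Lemma cls_mul a b : cls (gmul a b) = qmul (cls a) (cls b).
Proof. by apply/clP/gquot_mul; apply/gquot_sym/(rep_cl gquot_lcong). Qed.

Definition qhom (p : bool) : pred A := fun x => `[< exists2 t, ghom px t p & x = cls t >].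

Lemma qmulDl k (x y z : A) : qmul (k *: x + y) z = k *: qmul x z + qmul y z.
Proof.
rewrite -[x]cl_rep -[y]cl_rep -[z]cl_rep -cl_scale -cl_add -!cls_mul -cl_scale -cl_add.
apply: cl_gdn; apply: ge_trans (ge_mulDl _ _ _ _) _.
exact: ge_add (ge_mulZl _ _ _ _) (ge_refl _ _).
Qed.

Lemma qmulDr k (x y z : A) : qmul z (k *: x + y) = k *: qmul z x + qmul z y.
Proof.
rewrite -[x]cl_rep -[y]cl_rep -[z]cl_rep -cl_scale -cl_add -!cls_mul -cl_scale -cl_add.
apply: cl_gdn; apply: ge_trans (ge_mulDr _ _ _ _) _.
exact: ge_add (ge_mulZr _ _ _ _) (ge_refl _ _).
Qed.

Lemma qmulAl (x y z : A) : qmul (x + y) z = qmul x z + qmul y z.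
Proof. by rewrite -[x]scale1r qmulDl !scale1r. Qed.

Lemma qmulAr (x y z : A) : qmul z (x + y) = qmul z x + qmul z y.
Proof. by rewrite -[x]scale1r qmulDr !scale1r. Qed.

Lemma qhom0 p : qhom p 0.
Proof. by apply/asboolP; exists (gzero F X); first exact: gh_zero. Qed.

Lemma qhomD p k (x y : A) : qhom p x -> qhom p y -> qhom p (k *: x + y).
Proof.
move=> /asboolP [t ht ->] /asboolP [t' ht' ->]; apply/asboolP.
exists (gadd (gscale k t) t'); last by rewrite cl_add cl_scale.
by apply: gh_add => //; apply: gh_scale.
Qed.

Lemma qhomM p q (x y : A) : qhom p x -> qhom q y -> qhom (p (+) q) (qmul x y).
Proof.
move=> /asboolP [t ht ->] /asboolP [t' ht' ->]; apply/asboolP.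
by exists (gmul t t'); [apply: gh_mul|rewrite cls_mul].
Qed.

Lemma qsplit (x : A) : exists t0 t1,
  [/\ ghom px t0 false, ghom px t1 true & x = cls t0 + cls t1].
Proof.
have [t0 [t1 [h0 h1 /(cl_gdn gquot_lcong)]]] := gterm_split (rep x).
by rewrite cl_rep cl_add; exists t0, t1.
Qed.

(** The relation on terms is stated for homogeneous arguments; [z] is split into an even and an odd
    part. *)
Lemma qlsym p q (x y z : A) : qhom p x -> qhom q y ->
  qmul x (qmul y z) - qmul (qmul x y) z =
  sgn F p q *: (qmul y (qmul x z) - qmul (qmul y x) z).
Proof.
move=> /asboolP [t ht ->] /asboolP [t' ht' ->].
have [z0 [z1 [h0 h1 ->]]] := qsplit z.
have E r c : ghom px c r ->
    qmul (cls t) (qmul (cls t') (cls c)) - qmul (qmul (cls t) (cls t')) (cls c) =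
    sgn F p q *:
      (qmul (cls t') (qmul (cls t) (cls c)) - qmul (qmul (cls t') (cls t)) (cls c)).
  move=> hc; rewrite -!cls_mul -!cl_sub -cl_scale.
  exact/cl_gdn/(ge_lsym ht ht' hc).
rewrite !qmulAr !opprD [LHS]addrACA (E _ _ h0) (E _ _ h1) -scalerDr.
by congr (_ *: _); rewrite addrACA.
Qed.

Lemma qrcom p q (x y z : A) : qhom p y -> qhom q z ->
  qmul (qmul x y) z = sgn F p q *: qmul (qmul x z) y.
Proof.
move=> /asboolP [t ht ->] /asboolP [t' ht' ->].
have [z0 [z1 [h0 h1 ->]]] := qsplit x.
have E r c : ghom px c r -> qmul (qmul (cls c) (cls t)) (cls t') =
    sgn F p q *: qmul (qmul (cls c) (cls t')) (cls t).
  move=> hc; rewrite -!cls_mul -cl_scale; exact/cl_gdn/(ge_rcom hc ht ht').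
by rewrite !qmulAl (E _ _ h0) (E _ _ h1) scalerDr.
Qed.

Definition quotAlg : gdnSuper F :=
  GdnSuper qmulDl qmulDr qhom0 qhomD qhomM qlsym qrcom.

Lemma qhom_var x : @gh F quotAlg (px x) (cls (gvar F x)).
Proof. by apply/asboolP; exists (gvar F x); first exact: gh_var. Qed.

Definition qvar x : hel quotAlg := Hel (qhom_var x).

Hypothesis hS : forall s, S s -> exists (b : bool) t, ghom px t b /\ gdn_eq px s t.

Lemma ev_phi_cls u : ev qvar (phi u) (@wev F quotAlg) = cls u.
Proof.
have hom t p : ghom px t p -> ev qvar (phi t) (@wev F quotAlg) = cls t.
  case/(ev_phi_hom (A := quotAlg) (iota := qvar) (fun=> erefl) (cls := cls)) => //.
  - exact: cl_add.
  - exact: cl_scale.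
  - exact: cls_mul.
  by move=> h [<- _ ->]; rewrite ?wev1 //; apply: good_wev.
have [t0 [t1 [h0 h1 e]]] := gterm_split u.
rewrite (ev_sound (px := px) _ (phi_sound e)) //=; last exact: good_wev.
by rewrite (hom _ _ h0) (hom _ _ h1) (cl_gdn gquot_lcong e) cl_add.
Qed.

(** A generator is homogeneous up to [gdn_eq], so its image acts as one letter; the value of that
    letter is zero in the quotient, and [G] is linear in it. *)
Lemma ev_phi_set d : phi_set S d ->
  forall G, good (A := quotAlg) G -> ev qvar d G = 0.
Proof.
case=> s [Ss ->] G gG; have [b [t [ht e]]] := hS Ss.
rewrite (ev_sound (px := px) _ (phi_sound e)) //.
have [|||||h [hh _ ->]] // := ev_phi_hom (A := quotAlg) (iota := qvar)
  (fun=> erefl) (cls := cls) _ _ _ _ _ ht.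
- exact: cl_add.
- exact: cl_scale.
- exact: cls_mul.
apply: (hlin0 (@good_mlin _ _ _ gG [::] [::] 0%N)).
rewrite hh -(cl_gdn gquot_lcong e) -(cl_zero gquot_lcong); apply/clP.
by apply: (gideal_cl (gi_gen px Ss)); rewrite cl_sub cl_zero subr0.
Qed.

Lemma phi_inj u v : dquot px (phi_set S) (phi u) (phi v) -> gquot px S u v.
Proof.
(* The functional [wev] is good, so it kills the differential ideal; on the difference of [phi u]
   and [phi v] it gives the difference of the classes. *)
move=> uv; have := ev_dideal (A := quotAlg) (iota := qvar) (fun=> erefl) ev_phi_set uv
  (good_wev quotAlg).
rewrite /= !ev_phi_cls scaleN1r => /eqP; rewrite subr_eq0 => /eqP.
by move/clP.
Qed.

End QuotientAlgebra.

Theorem theorem3p8 (F : fieldType) (X : Type) (par : X -> bool)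
  (hF : (2%:R : F) != 0)
  (hX : exists R : X -> X -> Prop, well_order R)
  (S : gterm F X -> Prop)
  (hS : forall s, S s -> exists (b : bool) (t : gterm F X),
          ghom par t b /\ gdn_eq par s t) :
  let J := phi_set S in
  (* well defined *)
  (forall u v : gterm F X, gquot par S u v -> dquot par J (phi u) (phi v)) /\
  (* homomorphism of GDN superalgebras (parity preserving, linear, multiplicative) *)
  (forall (u : gterm F X) (b : bool), ghom par u b -> dhom par (phi u) b) /\
  (forall u v : gterm F X, dquot par J (phi (gadd u v)) (dadd (phi u) (phi v))) /\
  (forall (k : F) (u : gterm F X), dquot par J (phi (gscale k u)) (dscale k (phi u))) /\
  (forall u v : gterm F X, dquot par J (phi (gmul u v)) (dcirc (phi u) (phi v))) /\
  (* injective *)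
  (forall u v : gterm F X, dquot par J (phi u) (phi v) -> gquot par S u v).
Proof.
split; first by move=> u v; apply: phi_gideal.
split; first exact: phi_hom.
split; first by move=> u v; apply: dquot_refl.
split; first by move=> k u; apply: dquot_refl.
split; first by move=> u v; apply: dquot_refl.
by move=> u v; apply: phi_inj.
Qed.
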